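(* Let $G$ be the fundamental group of a finite graph of groups with virtually polycyclic vertex groups and finite edge groups. Then $G$ is strongly Howson and there exists a constant $M>0$ such that $$\xi_G(n_1,n_2)\leq M(n_1-1)(n_2-1)+M$$ for all integers $n_1,n_2\geq 1$.
   Context: For a finitely generated group $H$, the rank is $\mathrm{rk}(H) = \min\{|X| : H = \langle X\rangle\}$ (infinite if $H$ is not finitely generated). A group $G$ is strongly Howson if for all $n_1,n_2 \in \mathbb{N}$, $$\sup\{\mathrm{rk}(H_1\cap H_2) \mid H_1,H_2\leq G,\ \mathrm{rk}(H_1)\leq n_1,\ \mathrm{rk}(H_2)\leq n_2\} < \infty.$$ In that case $\xi_G(n_1,n_2)$ denotes this supremum. A group is polycyclic if it admits a finite subnormal series ending in $\{1\}$ with cyclic factors; it is virtually polycyclic if it has a polycyclic subgroup of finite index. A graph (in the sense of Serre) consists of a nonempty vertex set $V$, an edge set $E$, a map $\alpha:E\to V$ (initial vertex) and a fixed-point-free involution $e\mapsto\bar e$ on $E$. A finite graph of groups $\mathcal{G}$ over a finite connected graph consists of groups $G_v$ ($v\in V$, vertex groups), groups $G_e$ ($e\in E$, edge groups) with $G_{\bar e}=G_e$, and monomorphisms $\alpha_e:G_e\to G_{\alpha(e)}$ ($e\in E$). Given a spanning tree $T\subseteq E$, the fundamental group $\pi_1(\mathcal{G},T)$ is the quotient of $(\ast_{v\in V}G_v)\ast F_E$ ($F_E$ free on $E$) by the normal subgroup generated by $e\bar e$ ($e\in E$), $t$ ($t\in T$), and $e^{-1}\alpha_e(g)\,e\,\alpha_{\bar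 e}(g)^{-1}$ ($e\in E$, $g\in G_e$); up to isomorphism it does not depend on $T$. *)

(* Defs.v *)
From HB Require Import structures.
From mathcomp Require Import all_boot all_order all_algebra finmap.
From mathcomp Require Import boolp classical_sets cardinality.
From mathcomp Require Import reals constructive_ereal ereal.

Set Implicit Arguments.
Unset Strict Implicit.
Unset Printing Implicit Defensive.

Import Order.TTheory GRing.Theory Num.Theory.

Local Open Scope quotient_scope.
Local Open Scope classical_set_scope.
Local Open Scope group_scope.

(* Groups are [groupType]s, possibly infinite; subgroups are sets. *)

Section Subgroups.
Variable G : groupType.
Implicit Types (H K N X : set G).

Definition subgroup H : Prop :=
  H 1 /\ forall x y, H x -> H y -> H (x * y^-1).

Definition normal_in N H : Prop :=
  [/\ subgroup N, subgroup H, N `<=` H &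
      forall x h, N x -> H h -> N (h^-1 * x * h)].

Definition generated X : set G := smallest subgroup X.

Definition normal_closure X : set G :=
  smallest (fun N => normal_in N [set: G]) X.

Definition left_coset H (x : G) : set G := [set x * h | h in H].

Definition finite_index H : Prop := finite_set (range (left_coset H)).

(* H / N is cyclic: every coset of N in H is the coset of an element of the
   cyclic subgroup generated by some x in H. *)
Definition cyclic_factor H N : Prop :=
  exists2 x, H x &
    forall y, H y ->
      exists2 z, generated [set x] z & left_coset N y = left_coset N z.

Definition polycyclic H : Prop :=
  exists (n : nat) (S : nat -> set G),
    [/\ S 0 = H, S n = [set 1], subgroup H &
        forall i, (i < n)%N ->
          normal_in (S i.+1) (S i) /\ cyclic_factor (S i) (S i.+1)].

End Subgroups.

Definition virtually_polycyclic (G : groupType) : Prop :=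
  exists P : set G, [/\ subgroup P, finite_index P & polycyclic P].

Section Rank.
Variables (R : realType) (G : groupType).

(* The infimum over the empty set is +oo. *)
Definition rk (H : set G) : \bar R :=
  ereal_inf [set (#|` X|%fset%:R)%:E |
              X in [set X : {fset G} | H = generated [set` X]]].

Definition xi (n1 n2 : nat) : \bar R :=
  ereal_sup [set r | exists H1 H2 : set G,
    [/\ subgroup H1, subgroup H2, (rk H1 <= n1%:R%:E)%E,
        (rk H2 <= n2%:R%:E)%E & r = rk (H1 `&` H2)]].

Definition strongly_howson : Prop :=
  forall n1 n2 : nat, (xi n1 n2 < +oo)%E.

End Rank.

(* The free product of the groups A v (v : V) and the free group on E, as words
   modulo a congruence; the letter (e, true) stands for e^-1. *)
Section FreeProduct.
Variables (V E : choiceType) (A : V -> groupType).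

Definition letter : Type := ({v : V & A v} + E * bool)%type.

Definition vletter v (g : A v) : letter := inl (Tagged A g).
Definition eletter e (b : bool) : letter := inr (e, b).

Inductive fp_eq : seq letter -> seq letter -> Prop :=
| FpRefl w : fp_eq w w
| FpSym w1 w2 : fp_eq w1 w2 -> fp_eq w2 w1
| FpTrans w1 w2 w3 : fp_eq w1 w2 -> fp_eq w2 w3 -> fp_eq w1 w3
| FpCat u1 u2 w1 w2 :
    fp_eq u1 u2 -> fp_eq w1 w2 -> fp_eq (u1 ++ w1) (u2 ++ w2)
| FpOne v : fp_eq [:: @vletter v 1] [::]
| FpMul v (g h : A v) : fp_eq [:: vletter g; vletter h] [:: vletter (g * h)]
| FpInv e b : fp_eq [:: eletter e b; eletter e (~~ b)] [::].

Definition fp_eqb (w1 w2 : seq letter) : bool := `[< fp_eq w1 w2 >].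

Lemma fp_eqb_refl : reflexive fp_eqb.
Proof. by move=> w; apply/asboolP; apply: FpRefl. Qed.

Lemma fp_eqb_sym : symmetric fp_eqb.
Proof. by move=> w1 w2; apply/asboolP/asboolP; apply: FpSym. Qed.

Lemma fp_eqb_trans : transitive fp_eqb.
Proof.
by move=> w2 w1 w3 /asboolP h12 /asboolP h23; apply/asboolP; apply: FpTrans h23.
Qed.

Canonical fp_equiv := EquivRel fp_eqb fp_eqb_refl fp_eqb_sym fp_eqb_trans.

Definition free_product : Type := {eq_quot fp_equiv}.
HB.instance Definition _ := Choice.on free_product.

Definition fp_class (w : seq letter) : free_product := \pi_{eq_quot fp_equiv} w.

Lemma fp_classP w1 w2 : fp_class w1 = fp_class w2 <-> fp_eq w1 w2.
Proof.
split=> [h|h]; first by apply/asboolP; apply/(@eqmodP _ fp_equiv).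
by apply/(@eqmodP _ fp_equiv)/asboolP.
Qed.

Definition fp_repr (x : free_product) : seq letter := repr (x : {eq_quot fp_equiv}).

Lemma fp_reprK x : fp_class (fp_repr x) = x.
Proof. exact: reprK. Qed.

Lemma fp_repr_class w : fp_eq (fp_repr (fp_class w)) w.
Proof. by apply/fp_classP; rewrite fp_reprK. Qed.

Definition linv (l : letter) : letter :=
  match l with
  | inl (existT v g) => @vletter v g^-1
  | inr (e, b) => eletter e (~~ b)
  end.
Definition winv (w : seq letter) : seq letter := rev (map linv w).

Lemma winv_cat u w : winv (u ++ w) = winv w ++ winv u.
Proof. by rewrite /winv map_cat rev_cat. Qed.

Lemma linvK : involutive linv.
Proof. by case=> [[v g]|[e b]] /=; rewrite ?invgK ?negbK. Qed.

Lemma winvK : involutive winv.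
Proof. by move=> w; rewrite /winv map_rev revK mapK //; apply: linvK. Qed.

Lemma winv_eq u w : fp_eq u w -> fp_eq (winv u) (winv w).
Proof.
elim=> {u w} [w|u w _|u v w _ h1 _ h2|u1 u2 w1 w2 _ h1 _ h2|v|v g h|e b].
- exact: FpRefl.
- exact: FpSym.
- exact: FpTrans h2.
- by rewrite !winv_cat; apply: FpCat.
- by rewrite /winv /= /rev /= invg1; apply: FpOne.
- by rewrite /winv /= /rev /= invgM; apply: FpMul.
- by rewrite /winv /= /rev /= negbK; apply: FpInv.
Qed.

Lemma winvl w : fp_eq (winv w ++ w) [::].
Proof.
elim: w => [|l w IHw]; first exact: FpRefl.
rewrite -[l :: w]cat1s winv_cat -catA; apply: FpTrans IHw.
apply: FpCat; first exact: FpRefl.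
rewrite catA -[X in fp_eq _ X]cat0s; apply: FpCat; last exact: FpRefl.
case: l => [[v g]|[e b]]; rewrite /winv /rev /=.
  by apply: FpTrans (FpOne v); rewrite -(mulVg g); apply: FpMul.
by rewrite -{2}[b]negbK; apply: FpInv.
Qed.

Definition fp_mul (x y : free_product) := fp_class (fp_repr x ++ fp_repr y).
Definition fp_one := fp_class [::].
Definition fp_inv (x : free_product) := fp_class (winv (fp_repr x)).

Lemma fp_mulA : associative fp_mul.
Proof.
move=> x y z; apply/fp_classP; apply: FpTrans (_ : fp_eq (_ ++ (_ ++ _)) _).
  by apply: FpCat; [apply: FpRefl | apply: fp_repr_class].
by rewrite catA; apply: FpCat; [apply/FpSym/fp_repr_class | apply: FpRefl].
Qed.

Lemma fp_mul1 : left_id fp_one fp_mul.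
Proof.
move=> x; rewrite -[RHS]fp_reprK; apply/fp_classP.
rewrite -[X in fp_eq _ X]cat0s.
by apply: FpCat; [apply: fp_repr_class | apply: FpRefl].
Qed.

Lemma fp_mulr1 : right_id fp_one fp_mul.
Proof.
move=> x; rewrite -[RHS]fp_reprK; apply/fp_classP.
rewrite -[X in fp_eq _ X]cats0.
by apply: FpCat; [apply: FpRefl | apply: fp_repr_class].
Qed.

Lemma fp_mulV : left_inverse fp_one fp_inv fp_mul.
Proof.
move=> x; apply/fp_classP; apply: FpTrans (winvl (fp_repr x)).
by apply: FpCat; [apply: fp_repr_class | apply: FpRefl].
Qed.

Lemma fp_mulrV : right_inverse fp_one fp_inv fp_mul.
Proof.
move=> x; apply/fp_classP; apply: FpTrans (_ : fp_eq (_ ++ winv _) _).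
  by apply: FpCat; [apply: FpRefl | apply: fp_repr_class].
by rewrite -{1}[fp_repr x]winvK; apply: winvl.
Qed.

HB.instance Definition _ :=
  isGroup.Build free_product fp_mulA fp_mul1 fp_mulr1 fp_mulV fp_mulrV.

Definition fp_vertex v (g : A v) : free_product := fp_class [:: vletter g].
Definition fp_edge e : free_product := fp_class [:: eletter e false].

End FreeProduct.

Section Quotient.
Variables (G : groupType) (X : set G).

Definition nc_eqb (x y : G) : bool := `[< normal_closure X (x^-1 * y) >].

Lemma nc_subgroup : subgroup (normal_closure X).
Proof.
split=> [N [[[N1 _] _ _ _] _]|x y hx hy N hN]; first exact: N1.
have [[[_ NM] _ _ _] _] := hN.
by apply: NM; [apply: hx | apply: hy].
Qed.

Lemma nc1 : normal_closure X 1.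
Proof. by case: nc_subgroup. Qed.

Lemma ncV x : normal_closure X x -> normal_closure X x^-1.
Proof. by case: nc_subgroup => h1 h /(h _ _ h1); rewrite mul1g. Qed.

Lemma ncM x y :
  normal_closure X x -> normal_closure X y -> normal_closure X (x * y).
Proof.
by move=> hx /ncV; case: nc_subgroup => _ h /(h _ _ hx); rewrite invgK.
Qed.

Lemma ncJ x g : normal_closure X x -> normal_closure X (g^-1 * x * g).
Proof. by move=> hx N hN; have [[_ _ _ NJ] _] := hN; apply: NJ (hx N hN) _. Qed.

Lemma nc_eqb_refl : reflexive nc_eqb.
Proof. by move=> x; apply/asboolP; rewrite mulVg; apply: nc1. Qed.

Lemma nc_eqb_sym : symmetric nc_eqb.
Proof. by move=> x y; apply/asboolP/asboolP => /ncV; rewrite invgM invgK. Qed.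

Lemma nc_eqb_trans : transitive nc_eqb.
Proof.
move=> y x z /asboolP hxy /asboolP hyz; apply/asboolP.
by have := ncM hxy hyz; rewrite mulgA mulgK.
Qed.

Canonical nc_equiv := EquivRel nc_eqb nc_eqb_refl nc_eqb_sym nc_eqb_trans.

Definition quotient_group : Type := {eq_quot nc_equiv}.
HB.instance Definition _ := Choice.on quotient_group.

Definition q_class (x : G) : quotient_group := \pi_{eq_quot nc_equiv} x.
Definition q_repr (c : quotient_group) : G := repr (c : {eq_quot nc_equiv}).

Lemma q_classP x y : q_class x = q_class y <-> normal_closure X (x^-1 * y).
Proof.
split=> [h|h]; first by apply/asboolP; apply/(@eqmodP _ nc_equiv).
by apply/(@eqmodP _ nc_equiv)/asboolP.
Qed.

Lemma q_reprK c : q_class (q_repr c) = c.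
Proof. exact: reprK. Qed.

Definition q_mul (a b : quotient_group) := q_class (q_repr a * q_repr b).
Definition q_one := q_class 1.
Definition q_inv (a : quotient_group) := q_class (q_repr a)^-1.

Lemma q_classM x y : q_mul (q_class x) (q_class y) = q_class (x * y).
Proof.
apply/q_classP; set x' := q_repr _; set y' := q_repr _.
have hx : normal_closure X (x'^-1 * x) by apply/q_classP; rewrite q_reprK.
have hy : normal_closure X (y'^-1 * y) by apply/q_classP; rewrite q_reprK.
have -> : (x' * y')^-1 * (x * y) = (y'^-1 * (x'^-1 * x) * y') * (y'^-1 * y).
  by rewrite invgM !mulgA mulgK.
by apply: ncM => //; apply: ncJ.
Qed.

Lemma q_classV x : q_inv (q_class x) = q_class x^-1.
Proof.
apply/q_classP; set x' := q_repr _.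
have hx : normal_closure X (x'^-1 * x) by apply/q_classP; rewrite q_reprK.
rewrite invgK.
by have := ncJ x'^-1 (ncV hx); rewrite invgM !invgK mulgA mulgK.
Qed.

Lemma q_mulA : associative q_mul.
Proof.
move=> a b c; rewrite -[a]q_reprK -[b]q_reprK -[c]q_reprK !q_classM.
by rewrite mulgA.
Qed.

Lemma q_mul1 : left_id q_one q_mul.
Proof. by move=> a; rewrite -[a]q_reprK q_classM mul1g. Qed.

Lemma q_mulr1 : right_id q_one q_mul.
Proof. by move=> a; rewrite -[a]q_reprK q_classM mulg1. Qed.

Lemma q_mulV : left_inverse q_one q_inv q_mul.
Proof. by move=> a; rewrite -[a]q_reprK q_classV q_classM mulVg. Qed.

Lemma q_mulrV : right_inverse q_one q_inv q_mul.
Proof. by move=> a; rewrite -[a]q_reprK q_classV q_classM mulgV. Qed.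

HB.instance Definition _ :=
  isGroup.Build quotient_group q_mulA q_mul1 q_mulr1 q_mulV q_mulrV.

End Quotient.

Record finite_graph := FiniteGraph {
  vertex : finType;
  edge : finType;
  source : edge -> vertex;
  rev_edge : edge -> edge;
  vertex_gt0 : (0 < #|vertex|)%N;
  rev_edgeK : involutive rev_edge;
  rev_edge_neq : forall e, rev_edge e != e
}.

Section Graphs.
Variable Gamma : finite_graph.
Implicit Types (e f : edge Gamma) (T : {set edge Gamma}).

Definition target e : vertex Gamma := source (rev_edge e).

Definition adjacent T : rel (vertex Gamma) :=
  fun u v => [exists e in T, (source e == u) && (target e == v)].

Definition connected_by T : Prop := forall u v, connect (adjacent T) u v.

Definition graph_connected : Prop := connected_by [set: edge Gamma].

Definition reduced_step T : rel (edge Gamma) :=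
  fun e f => [&& f \in T, source f == target e & f != rev_edge e].

(* No nonempty reduced path in T is closed. *)
Definition acyclic T : Prop :=
  forall e (p : seq (edge Gamma)),
    e \in T -> path (reduced_step T) e p -> target (last e p) != source e.

Definition spanning_tree T : Prop :=
  [/\ forall e, e \in T -> rev_edge e \in T, connected_by T & acyclic T].

End Graphs.

Record graph_of_groups := GraphOfGroups {
  graph : finite_graph;
  graph_conn : graph_connected graph;
  vgroup : vertex graph -> groupType;
  egroup : edge graph -> groupType;
  egroup_rev : forall e, egroup (rev_edge e) = egroup e;
  emap : forall e, {multiplicative egroup e -> vgroup (source e)};
  emap_inj : forall e, injective (emap e)
}.

Section FundamentalGroup.
Variable GG : graph_of_groups.

(* An element of G_e seen in G_(rev e), which is the same group. *)
Definition to_rev (e : edge (graph GG)) (g : egroup e) : egroup (rev_edge e) :=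
  ecast K (K : groupType) (esym (egroup_rev e)) g.

Local Notation FP := (free_product (edge (graph GG)) (@vgroup GG)).
Local Notation "[ 'e' x ]" := (fp_edge (@vgroup GG) x).
Local Notation "[ 'v' g ]" := (fp_vertex (edge (graph GG)) g).

Definition pi1_relators (T : {set edge (graph GG)}) : set FP :=
  [set [e x] * [e rev_edge x] | x in [set: edge (graph GG)]]
  `|` [set [e t] | t in [set` T]]
  `|` [set r | exists (x : edge (graph GG)) (g : egroup x),
        r = [e x]^-1 * [v emap x g] * [e x]
            * [v emap (rev_edge x) (to_rev g)]^-1].

Definition pi1 (T : {set edge (graph GG)}) : groupType :=
  quotient_group (pi1_relators T).

End FundamentalGroup.

(* Main.v *)
From HB Require Import structures.
From mathcomp Require Import all_boot all_order all_algebra all_fingroup finmap.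
From mathcomp Require Import boolp classical_sets cardinality.
From mathcomp Require Import reals constructive_ereal ereal.
From mathcomp Require Import zify.
Require Import Defs.

Set Implicit Arguments.
Unset Strict Implicit.
Unset Printing Implicit Defensive.

Import Order.TTheory GRing.Theory Num.Theory.

(** The fundamental group [G] acts on its Bass-Serre tree with finite edge
    stabilisers, of order at most [m], and with vertex stabilisers all of whose
    subgroups are generated by a bounded number [r] of elements, because they are
    virtually polycyclic.  The bound on [rk (H1 /\ H2)] comes from counting, for a
    subgroup [H], the branching of the subtree [S_H] spanned by the orbit [H p]
    of a fixed vertex [p]: a branch half-edge of [H] is a half-edge of [S_H]
    that starts at a vertex of degree at least 3 in [S_H].

    If [H] is generated by [n] elements, its branch half-edges form at most
    [6 m (n + 1)] orbits ([branch_bound]).  Choose a finite set [B] on which [G]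
    acts and consider the quotient of [S_H x B] by [H].  It is a finite graph
    with at most [n #|B|] more edges than vertices: modulo 2, a function on the
    edges is determined by its sums along the paths from [p] to the images of [p]
    by the generators and from [p] to representatives of the vertices
    ([euler_bound]).  On the other hand the sum of [degree - 2] over its vertices
    is twice that excess.  To conclude, the degree of a vertex must not drop from
    at least 3 to less than 3, nor from 2 to 1, in the quotient; this holds when
    finitely many given elements of vertex stabilisers have no fixed point in
    [B].  Such a [B] exists because virtually polycyclic groups are residually
    finite: finite quotients of the vertex groups can be put together into an
    action of [G], since two free actions of an edge group on a finite set are
    isomorphic ([pi1_finite_action]).

    Put [K = H1 /\ H2].  As [S_K] is contained in [S_H1] and in [S_H2], a branch
    half-edge of [K] is one of both [H1] and [H2], so the branch half-edges of
    [K] form at most [m N1 N2] orbits, where [N1] and [N2] are the numbers for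
    [H1] and [H2] ([orbits_setI]).  The vertices of degree at least 3 and the
    orbit of [p] cut [S_K] into arcs, and [K] is generated by the stabilisers of
    representatives of these vertices and by boundedly many elements for each
    orbit of arcs ([gen_by_special]).  Hence the rank of [K] is at most a constant
    times [(n1 + 1) (n2 + 1)].  For [n1, n2 >= 2] this is at most a constant times
    [(n1 - 1) (n2 - 1)], and if [n1] or [n2] is 1 then [K] is cyclic.

    The Bass-Serre tree is the set of cosets of the vertex groups.  That it is a
    tree is deduced from the universal property of [G] alone: a homomorphism to
    the semidirect product of the functions on the edges by [G] gives for each
    edge a two-colouring of the vertices that changes across this edge and across
    no other ([bs_side]). *)

(** * Generators of subgroups *)

(* Rewriting with this rule computes the reduced form of a group word. *)
Local Notation gE :=
  (invgM, invgK, invg1, mulgA, mulg1, mul1g, mulgK, mulgVK, mulgV, mulVg).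

Section Generation.
Local Open Scope classical_set_scope.
Local Open Scope group_scope.
Variable G : groupType.
Implicit Types (H K N X : set G) (s : seq G).

Lemma subgroup1 H : subgroup H -> H 1.
Proof. by case. Qed.

Lemma subgroupV H x : subgroup H -> H x -> H x^-1.
Proof. by case=> h1 h hx; have := h _ _ h1 hx; rewrite mul1g. Qed.

Lemma subgroupM H x y : subgroup H -> H x -> H y -> H (x * y).
Proof.
move=> hH hx hy; have := hH.2 _ _ hx (subgroupV hH hy); by rewrite invgK.
Qed.

Lemma subgroupI H K : subgroup H -> subgroup K -> subgroup (H `&` K).
Proof.
move=> hH hK; split; first by split; apply: subgroup1.
move=> x y [hx kx] [hy ky].
by split; apply: subgroupM => //; apply: subgroupV.
Qed.

Lemma generated_subgroup X : subgroup (generated X).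
Proof.
split=> [K [hK _]|x y hx hy K hK]; first exact: subgroup1.
by have [[_ hM] _] := hK; apply: hM; [apply: hx | apply: hy].
Qed.

Lemma sub_generated X : X `<=` generated X.
Proof. by move=> x hx K [_]; apply. Qed.

Lemma generated_min X H : subgroup H -> X `<=` H -> generated X `<=` H.
Proof. by move=> hH hX x; apply. Qed.

Lemma generated_mono X Y : X `<=` Y -> generated X `<=` generated Y.
Proof.
move=> hXY; apply: generated_min; first exact: generated_subgroup.
exact: subset_trans hXY (@sub_generated _).
Qed.

(** The inequality [rk H <= n], kept in the natural numbers until the end. *)
Definition gen_by H (n : nat) : Prop :=
  exists2 s, (size s <= n)%N & H = generated [set` s].

Lemma gen_byP H n s : subgroup H -> (size s <= n)%N -> [set` s] `<=` H ->
  H `<=` generated [set` s] -> gen_by H n.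
Proof.
move=> hH hs sH Hs; exists s => //.
by apply/seteqP; split=> //; apply: generated_min.
Qed.

Lemma gen_by_mono H m n : (m <= n)%N -> gen_by H m -> gen_by H n.
Proof. by move=> mn [s hs ->]; exists s => //; apply: leq_trans mn. Qed.

Lemma gen_by_cat H n1 n2 K1 K2 : subgroup H ->
  gen_by K1 n1 -> gen_by K2 n2 -> K1 `<=` H -> K2 `<=` H ->
  H `<=` generated (K1 `|` K2) -> gen_by H (n1 + n2).
Proof.
move=> hH [s1 hs1 ->] [s2 hs2 ->] h1 h2 h.
apply: (@gen_byP _ _ (s1 ++ s2)) => //.
- by rewrite size_cat leq_add.
- move=> x /=; rewrite mem_cat => /orP[] hx; [apply: h1 | apply: h2];
  exact: sub_generated.
- apply: subset_trans h _; apply: generated_min.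
    exact: generated_subgroup.
  by move=> x [] hx; apply: generated_mono hx => y /= hy;
    rewrite mem_cat hy ?orbT.
Qed.

Lemma gen_by_cycle (x : G) : gen_by (generated [set x]) 1.
Proof.
exists [:: x] => //; congr generated; apply/seteqP; split=> y /=.
  by move=> ->; rewrite inE.
by rewrite inE => /eqP.
Qed.

Lemma generated_cycleP (x z : G) :
  generated [set x] z -> exists i, z = x ^+ i \/ z = x ^- i.
Proof.
move=> hz; suff: [set z | exists i, z = x ^+ i \/ z = x ^- i] z by [].
apply: hz; split; last by move=> _ ->; exists 1%N; left; rewrite expg1.
split; first by exists 0%N; left.
have hM i j : exists k, x ^+ i * x ^- j = x ^+ k \/ x ^+ i * x ^- j = x ^- k.
  have [ij|ji] := leqP i j.
    exists (j - i)%N; right; rewrite -(subnK ij) expgnDr invgM mulVKg.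
    by rewrite addnK.
  exists (i - j)%N; left.
  by rewrite -{1}(subnK (ltnW ji)) expgnDr mulgK.
have cV i j : x ^- i * x ^+ j = x ^+ j * x ^- i.
  by apply: commuteX; apply: commute_sym; apply: commuteV; apply: commuteX.
move=> _ _ [i [->|->]] [j [->|->]].
- exact: hM.
- by exists (i + j)%N; left; rewrite invgK expgnDr.
- exists (j + i)%N; right; by rewrite expgnDr invgM.
- by rewrite invgK cV; apply: hM.
Qed.

End Generation.

Section RankBridge.
Local Open Scope classical_set_scope.
Local Open Scope ereal_scope.
Variables (R : realType) (G : groupType).
Implicit Type H : set G.

Lemma gen_by_rk H n : gen_by H n -> rk R H <= n%:R%:E.
Proof.
case=> s hs hH.
apply: (@le_trans _ _ (#|` [fset x in s]%fset|%:R%:E)).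
  apply: ereal_inf_lbound; exists [fset x in s]%fset => //=.
  rewrite {1}hH; congr generated; apply/seteqP; split=> x /=; by rewrite !inE.
rewrite lee_fin ler_nat; apply: leq_trans hs.
by rewrite card_fseq size_undup.
Qed.

(** The infimum that defines the rank is attained, being taken over natural
    numbers. *)
Lemma rk_gen_by H n : rk R H <= n%:R%:E -> gen_by H n.
Proof.
move=> hr; apply: contrapT => hn.
suff: (n.+1%:R%:E <= rk R H).
  by move=> /le_trans/(_ hr); rewrite lee_fin ler_nat ltnn.
apply: le_ereal_inf_tmp => _ [X /= hX <-]; rewrite lee_fin ler_nat ltnNge.
by apply: contra_notN hn => hXn; exists (enum_fset X).
Qed.

End RankBridge.

(** * Virtually polycyclic groups *)

Section Polycyclic.
Local Open Scope classical_set_scope.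
Local Open Scope group_scope.
Variable G : groupType.
Implicit Types (H K N X : set G) (s : seq G) (x y z : G).

Lemma subgroupX H x i : subgroup H -> H x -> H (x ^+ i).
Proof.
move=> hH hx; elim: i => [|i IHi]; first exact: subgroup1.
by rewrite expgS; apply: subgroupM.
Qed.

Lemma cyclic_factorP H N : cyclic_factor H N -> subgroup N ->
  exists2 x, H x & forall y, H y -> exists i, N (x ^- i * y) \/ N (x ^+ i * y).
Proof.
move=> [x hx hxN] hN; exists x => // y /hxN[z /generated_cycleP[i hi] hyz].
have [h Nh zh] : left_coset N z y.
  by rewrite -hyz; exists 1; rewrite ?mulg1 //; apply: subgroup1.
exists i; case: hi => zi; [left|right]; rewrite -zh zi ?mulKg //.
by rewrite mulVKg.
Qed.

(** A subgroup of a cyclic group is generated by its smallest positive power;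
    here this is read modulo [N]. *)
Lemma gen_by_cyclic_ext H N K n : normal_in N H -> cyclic_factor H N ->
  subgroup K -> K `<=` H -> gen_by (K `&` N) n -> gen_by K n.+1.
Proof.
move=> [hN hH NH NJ] hc hK KH hKN.
have [x Hx hx] := cyclic_factorP hc hN.
pose P d := `[< (0 < d)%N /\ exists2 k, K k & N (x ^- d * k) >].
suff [k0 Kk0 hk0] : exists2 k0, K k0 & forall i k, K k -> N (x ^- i * k) ->
    generated ((K `&` N) `|` generated [set k0]) k.
  rewrite -addn1; apply: (gen_by_cat hK hKN (gen_by_cycle k0)).
  - by move=> k [].
  - by apply: generated_min => // _ ->.
  - move=> k Kk; have [i [hi|hi]] := hx _ (KH _ Kk); first exact: hk0 hi.
    rewrite -[k]invgK; apply: (subgroupV (generated_subgroup _)).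
    apply: (hk0 i); first exact: subgroupV.
    have /NJ/(_ (subgroupX i hH Hx)) := subgroupV hN hi.
    by rewrite invgM !mulgA mulgVK.
have inN k0 k : K k -> N k ->
    generated ((K `&` N) `|` generated [set k0]) k.
  by move=> Kk Nk; apply: sub_generated; left.
have [hP|hP] := pselect (exists d, P d); last first.
  exists 1; first exact: subgroup1.
  move=> [|i] k Kk hk; first by apply: inN; move: hk; rewrite invg1 mul1g.
  by case: hP; exists i.+1; apply/asboolP; split=> //; exists k.
case: (ex_minnP hP) => d /asboolP[d0 [k0 Kk0 hk0]] dmin; exists k0 => //.
elim/ltn_ind => i IHi k Kk hk.
have [id|di] := ltnP i d.
  case: i id hk {IHi} => [|i] id hk; first by apply: inN; rewrite invg1 mul1g in hk.
  have /dmin : P i.+1 by apply/asboolP; split=> //; exists k.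
  by rewrite leqNgt id.
rewrite -(mulVKg k0 k); apply: (subgroupM (generated_subgroup _)).
  by apply: sub_generated; right; apply: sub_generated.
apply: (IHi (i - d)%N); first by lia.
  by apply: subgroupM => //; apply: subgroupV.
have := NJ _ _ (subgroupV hN hk0) (subgroupX (i - d) hH Hx).
move=> /(subgroupM hN)/(_ hk); rewrite invgM !invgK !mulgA.
suff -> : x ^- (i - d) * k0^-1 * x ^+ d * x ^+ (i - d) * x ^- i * k =
          x ^- (i - d) * k0^-1 * k by [].
by rewrite -(mulgA _ (x ^+ d)) -expgnDr subnKC // mulgK.
Qed.

(** Finite index of [K] in [N]; the coset representatives may lie outside [N],
    which makes the transitivity of this relation immediate. *)
Definition rel_fin K N : Prop :=
  exists s, forall h, N h -> exists2 a, a \in s & K (a^-1 * h).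

Lemma rel_fin_trans K N H : rel_fin K N -> rel_fin N H -> rel_fin K H.
Proof.
move=> [s hs] [t ht]; exists [seq a * b | a <- t, b <- s] => h Hh.
have [a at_ /hs[b bs hb]] := ht h Hh.
by exists (a * b); [apply: allpairs_f | rewrite invgM -mulgA].
Qed.

Lemma rel_fin_range (T : finType) (f : G -> T) K N :
  (forall a b, N a -> N b -> f a = f b -> K (a^-1 * b)) -> rel_fin K N.
Proof.
move=> hf; pose pk t := xget 1 [set a | N a /\ f a = t].
exists [seq pk t | t <- enum T] => h Nh; exists (pk (f h)).
  by apply: map_f; rewrite mem_enum.
have : [set a | N a /\ f a = f h] (pk (f h)).
  by apply: (@xgetPex _ 1 [set a | N a /\ f a = f h]); exists h.
by case=> Npk fpk; apply: hf.
Qed.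

(** Numbering the cosets by a fixed set of integers allows the coset spaces of
    different subgroups to be compared. *)
Lemma rel_fin_index K N : subgroup K -> rel_fin K N ->
  exists (k : nat) (c : G -> 'I_k.+1),
    forall a b, N a -> N b -> (c a = c b <-> K (a^-1 * b)).
Proof.
move=> hK [s hs].
pose idx a := find (fun b => `[< K (b^-1 * a) >]) s.
have idx_lt a : (idx a < (size s).+1)%N by rewrite ltnS find_size.
exists (size s), (fun a => Ordinal (idx_lt a)) => a b Na Nb; split.
  move=> [] eab; have [u us Ku] := hs a Na; have [v vs Kv] := hs b Nb.
  have ha : has (fun w => `[< K (w^-1 * a) >]) s.
    by apply/hasP; exists u => //; apply/asboolP.
  have hb : has (fun w => `[< K (w^-1 * b) >]) s.
    by apply/hasP; exists v => //; apply/asboolP.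
  have /asboolP ka := nth_find 1 ha; have /asboolP kb := nth_find 1 hb.
  rewrite -/(idx a) eab in ka; rewrite -/(idx b) in kb.
  by have := subgroupM hK (subgroupV hK ka) kb; rewrite !gE.
move=> kab; apply: val_inj => /=; apply: eq_find => w.
apply: asbool_equiv_eq; split=> h.
  by have := subgroupM hK h kab; rewrite !gE.
by have := subgroupM hK h (subgroupV hK kab); rewrite !gE.
Qed.

(** Words in the generators and their inverses are built from the right. *)
Lemma generated_ind X (P : set G) : P 1 ->
  (forall g a, X g -> generated X a -> P a -> P (g * a) /\ P (g^-1 * a)) ->
  forall a, generated X a -> P a.
Proof.
move=> P1 hP a Xa.
pose Q := [set g | generated X g /\ forall b, generated X b -> P b ->
                     P (g * b) /\ P (g^-1 * b)].
suff : Q a by case=> _ /(_ 1 (subgroup1 (generated_subgroup _)) P1); rewrite mulg1 => -[].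
have gS := generated_subgroup X.
apply: Xa; split; last first.
  by move=> g Xg; split; [apply: sub_generated | move=> b; apply: hP].
split; first by split=> [|b _]; [apply: (subgroup1 gS) | rewrite invg1 mul1g].
move=> g h [Xg Pg] [Xh Ph]; split.
  by apply: (subgroupM gS) => //; apply: (subgroupV gS).
move=> b Xb Pb; rewrite invgM invgK -!mulgA; split.
- apply Pg; last by apply Ph.
  by apply: (subgroupM gS) => //; apply: (subgroupV gS).
- apply Ph; last by apply Pg.
  by apply: (subgroupM gS) => //; apply: (subgroupV gS).
Qed.

(** The conjugates of [K] by [H] all have the same index in the finitely
    generated group [N], and a subgroup of index [k] is determined by the
    permutations that the generators of [N] induce on its [k] cosets; so there
    are finitely many conjugates, and their intersection has finite index. *)
Lemma normal_core_rel_fin H N K n : normal_in N H -> gen_by N n ->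
  subgroup K -> K `<=` N -> rel_fin K N ->
  exists K0, [/\ normal_in K0 H, K0 `<=` K & rel_fin K0 N].
Proof.
move=> [hN hH NH NJ] [s _ Ns] hK KN fK.
have [k [c hc]] := rel_fin_index hK fK.
exists [set x | forall z, H z -> K (z^-1 * x * z)]; split.
- split=> //.
  + split=> [z Hz|x y hx hy z Hz]; first by rewrite mulg1 mulVg; apply: subgroup1.
    have := subgroupM hK (hx z Hz) (subgroupV hK (hy z Hz)).
    by rewrite !invgM invgK !mulgA mulgK.
  + move=> x /(_ 1 (subgroup1 hH)); rewrite invg1 mul1g mulg1 => /KN/NH //.
  + move=> x h hx Hh z Hz.
    by have := hx _ (subgroupM hH Hh Hz); rewrite invgM !mulgA.
- by move=> x /(_ 1 (subgroup1 hH)); rewrite invg1 mul1g mulg1.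
pose cz z a := c (z^-1 * a * z).
have hcz z a b : H z -> N a -> N b -> (cz z a = cz z b <-> K (z^-1 * (a^-1 * b) * z)).
  move=> Hz Na Nb; rewrite hc; [|exact: NJ..].
  suff -> : (z^-1 * a * z)^-1 * (z^-1 * b * z) = z^-1 * (a^-1 * b) * z by [].
  by rewrite !invgM invgK !mulgA mulgK.
pose gen (j : 'I_(size s) * bool) := if j.2 then s`_j.1 else (s`_j.1)^-1.
have Nnth (j : 'I_(size s)) : N (s`_j).
  by rewrite Ns; apply: sub_generated => /=; apply: mem_nth.
have Ngen j : N (gen j).
  rewrite /gen; case: ifP => _; first exact: Nnth.
  by apply: subgroupV => //; apply: Nnth.
pose tau z j i := cz z (gen j * xget 1 [set a | N a /\ cz z a = i]).
have tauE z j a : H z -> N a -> cz z (gen j * a) = tau z j (cz z a).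
  move=> Hz Na; set i := cz z a.
  have [Nb bi] : [set b | N b /\ cz z b = i] (xget 1 [set b | N b /\ cz z b = i]).
    by apply: (@xgetPex _ 1 [set b | N b /\ cz z b = i]); exists a.
  apply/hcz => //; try by apply: subgroupM.
  rewrite invgM -(mulgA a^-1) mulKg; apply/hcz => //; exact: esym bi.
(* The conjugate of [K] by [z] is the fibre of [cz z] at [cz z 1], and
   [cz z] is determined by its value at [1] and by the action of the generators
   on the labels of the cosets: [code z] has finitely many values. *)
pose code z := (cz z 1, [ffun j => [ffun i => tau z j i]]).
have code_inj z w a : H z -> H w -> code z = code w -> N a -> cz z a = cz w a.
  move=> Hz Hw [e1 /ffunP et]; rewrite Ns; move: a.
  apply: (@generated_ind _ [set a | cz z a = cz w a]) => //= g b gs.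
  rewrite -Ns => Nb eb.
  have gi : (index g s < size s)%N by rewrite index_mem.
  suff hj : forall j, cz z (gen j * b) = cz w (gen j * b).
    have := hj (Ordinal gi, true); have := hj (Ordinal gi, false).
    by rewrite /gen /= nth_index.
  move=> j; rewrite !tauE // eb.
  by have := et j; rewrite !ffunE => /ffunP/(_ (cz w b)); rewrite !ffunE.
pose rep t := xget 1 [set z | H z /\ code z = t].
pose f a := [ffun t => cz (rep t) a].
apply: (@rel_fin_range _ f) => a b Na Nb /ffunP fab z Hz; apply/hcz => //.
have [Hr rz] : [set w | H w /\ code w = code z] (rep (code z)).
  by apply: (@xgetPex _ 1 [set w | H w /\ code w = code z]); exists z.
have := fab (code z); rewrite !ffunE.
by rewrite -(code_inj z) // -(code_inj z).
Qed.

Definition resid_fin H : Prop := forall y, H y -> y <> 1 ->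
  exists K, [/\ subgroup K, K `<=` H, rel_fin K H & ~ K y].

(** The subgroup [<x> K], when [x] normalises [K]. *)
Definition cyc_ext K x : set G :=
  [set h | exists2 z, generated [set x] z & K (z^-1 * h)].

Lemma cyc_ext_subgroup K H x : normal_in K H -> H x ->
  [/\ subgroup (cyc_ext K x), K `<=` cyc_ext K x, cyc_ext K x x &
      cyc_ext K x `<=` H].
Proof.
move=> [hK hH KH KJ] Hx; have gS := generated_subgroup [set x].
have gH : generated [set x] `<=` H by apply: generated_min => // _ ->.
split.
- split=> [|h1 h2 [z1 g1 k1] [z2 g2 k2]].
    by exists 1; rewrite ?invg1 ?mul1g; [exact: (subgroup1 gS)|exact: subgroup1].
  exists (z1 * z2^-1); first by apply: (subgroupM gS) => //; apply: (subgroupV gS).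
  have := KJ _ _ (subgroupM hK k1 (subgroupV hK k2)) (gH _ (subgroupV gS g2)).
  by rewrite !gE.
- by move=> k Kk; exists 1; rewrite ?invg1 ?mul1g //; exact: (subgroup1 gS).
- by exists x; [apply: sub_generated | rewrite mulVg; apply: subgroup1].
- move=> h [z /gH Hz /KH Hzh]; rewrite -(mulVKg z h); exact: subgroupM.
Qed.

(** Every element of [H] is a power of [x] modulo [M], and the order of [x]
    modulo [M] divides [d]. *)
Lemma rel_fin_power N M H x d : subgroup N -> subgroup M -> N `<=` M ->
  (0 < d)%N -> M (x ^+ d) ->
  (forall y, H y -> exists i, N (x ^- i * y) \/ N (x ^+ i * y)) ->
  rel_fin M H.
Proof.
move=> hN hM NM d0 Md hx; exists [seq x ^+ i | i <- iota 0 d.+1] => h Hh.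
have Mq q : M (x ^+ (q * d)) by rewrite mulnC expgnA; apply: subgroupX.
have [i [/NM Mi|/NM Mi]] := hx h Hh.
  exists (x ^+ (i %% d)).
    by apply: map_f; rewrite mem_iota /= add0n ltnS ltnW // ltn_pmod.
  have := subgroupM hM (Mq (i %/ d)) Mi.
  rewrite {2}(divn_eq i d) expgnDr invgM !mulgA.
  suff -> : x ^+ (i %/ d * d) * x ^- (i %% d) = x ^- (i %% d) * x ^+ (i %/ d * d).
    by rewrite mulgK.
  by apply: commuteV; apply: commuteX2.
exists (x ^+ (d - i %% d)).
  by apply: map_f; rewrite mem_iota /= add0n ltnS leq_subr.
have := subgroupM hM (subgroupV hM (Mq (i %/ d).+1)) Mi.
have -> : ((i %/ d).+1 * d = i + (d - i %% d))%N.
  have := divn_eq i d; have := ltn_pmod i d0; rewrite mulSn; lia.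
by rewrite expgnDr invgM mulgA mulgVK.
Qed.

(** If [H / N] is infinite cyclic, generated by [x], an element of [N] is
    separated from [1] by [<x> K0] with [K0] a subgroup of [N] normal in [H],
    and an element outside [N] by the preimage of a subgroup of [H / N]. *)
Lemma resid_fin_cyclic_ext H N n : normal_in N H -> cyclic_factor H N ->
  gen_by N n -> resid_fin N -> resid_fin H.
Proof.
move=> nNH hc gN rN y Hy y1.
have [hN hH NH NJ] := nNH; have [x Hx hx] := cyclic_factorP hc hN.
have [[d [d0 Nd]]|nod] := pselect (exists d, (0 < d)%N /\ N (x ^+ d)).
  have fN : rel_fin N H by apply: (@rel_fin_power N N H x d).
  have [Ny|Ny] := pselect (N y); last by exists N.
  have [K [hK KN fK nK]] := rN y Ny y1; exists K; split=> //.
    exact: subset_trans NH.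
  exact: rel_fin_trans fN.
have expN i : N (x ^+ i) -> i = 0%N.
  by case: i => // i Ni; case: nod; exists i.+1.
have powN a b : N (x ^- a * x ^+ b) -> a = b.
  move=> h; have [ab|ba] := leqP a b.
    move: h; rewrite -{1}(subnKC ab) expgnDr mulKg => /expN; lia.
  have := subgroupV hN h; rewrite invgM invgK -{1}(subnKC (ltnW ba)).
  by rewrite expgnDr mulKg => /expN; lia.
have [Ny|Ny] := pselect (N y).
  have [K [hK KN fK nK]] := rN y Ny y1.
  have [K0 [nK0 K0K [s fK0]]] := normal_core_rel_fin nNH gN hK KN fK.
  have [hM KM Mx MH] := cyc_ext_subgroup nK0 Hx.
  have gH : generated [set x] `<=` H by apply: generated_min => // _ ->.
  exists (cyc_ext K0 x); split=> //.
    exists s => h Hh.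
    have [z zx Nz] : exists2 z, generated [set x] z & N (h * z^-1).
      have gx : generated [set x] x by apply: sub_generated.
      have gS := generated_subgroup [set x].
      have [i [Ni|Ni]] := hx h Hh.
        exists (x ^+ i); first exact: (subgroupX i gS).
        have := NJ _ _ Ni (subgroupV hH (subgroupX i hH Hx)).
        by rewrite !gE.
      exists (x ^- i); first by apply: (subgroupV gS); apply: (subgroupX i gS).
      have := NJ _ _ Ni (subgroupX i hH Hx).
      by rewrite !gE.
    have [a as_ Ka] := fK0 _ Nz; exists a => //; exists z => //.
    have [_ _ _ KJ] := nK0; have := KJ _ _ Ka (gH _ zx).
    by rewrite !gE.
  move=> [z /generated_cycleP[i zi] Kz].
  have Nz : N z.
    by have := subgroupM hN Ny (subgroupV hN (KN _ (K0K _ Kz)));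
       rewrite !gE.
  have i0 : i = 0%N.
    case: zi => zi; apply: expN; first by rewrite -zi.
    by rewrite -[x ^+ i]invgK -zi; apply: subgroupV.
  have z1 : z = 1 by case: zi => ->; rewrite i0 ?invg1.
  by apply: nK; apply: K0K; move: Kz; rewrite z1 invg1 mul1g.
have [i hi] := hx y Hy.
have [hM NM Mx MH] := cyc_ext_subgroup nNH (subgroupX i.+1 hH Hx).
exists (cyc_ext N (x ^+ i.+1)); split=> //.
  exact: (@rel_fin_power N _ H x i.+1).
have i0 : i <> 0%N.
  by move=> i0; apply: Ny; case: hi; rewrite i0 ?invg1 mul1g.
move=> [z /generated_cycleP[j zj] Nz].
have [w Nw wE] : exists2 w, N (z^-1 * w) & w = x ^+ i \/ w = x ^- i.
  case: hi => hi; [exists (x ^+ i)|exists (x ^- i)]; auto;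
  by have := subgroupM hN Nz (subgroupV hN hi); rewrite !gE.
have ji : (i.+1 * j)%N <> i.
  by case: (j) => [|k]; rewrite ?muln0 ?mulnS; lia.
move: Nw; rewrite -expgnA in zj.
case: zj => ->; case: wE => -> h.
- by move/powN: h.
- by have := subgroupV hN h; rewrite invgM !invgK -expgnDr => /expN; lia.
- by move: h; rewrite invgK -expgnDr => /expN; lia.
- apply: ji; apply/esym/powN; move: h; rewrite invgK.
  suff -> : x ^- i * x ^+ (i.+1 * j) = x ^+ (i.+1 * j) * x ^- i by [].
  by apply: commute_sym; apply: commuteV; apply: commuteX2.
Qed.

Lemma polycyclic_subgroup_rank (S : nat -> set G) n :
  S n = [set 1] ->
  (forall i, (i < n)%N ->
     normal_in (S i.+1) (S i) /\ cyclic_factor (S i) (S i.+1)) ->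
  forall K, subgroup K -> K `<=` S 0 -> gen_by K n.
Proof.
elim: n S => [|n IHn] S Sn hS K hK KS.
  apply: (@gen_byP _ _ _ [::]) => // x /KS; rewrite Sn => ->.
  exact: (subgroup1 (generated_subgroup _)).
have [nS cS] := hS 0%N isT.
apply: (gen_by_cyclic_ext nS cS) => //.
apply: (IHn (S \o succn)) => //; last first.
  by have [hN _ _ _] := nS; exact: subgroupI.
by move=> i; apply: (hS i.+1).
Qed.

Lemma polycyclic_resid_fin (S : nat -> set G) n :
  S n = [set 1] ->
  (forall i, (i < n)%N ->
     normal_in (S i.+1) (S i) /\ cyclic_factor (S i) (S i.+1)) ->
  resid_fin (S 0).
Proof.
elim: n S => [|n IHn] S Sn hS; first by rewrite Sn => y ->.
have [nS cS] := hS 0%N isT.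
have hS' i : (i < n)%N ->
     normal_in (S i.+2) (S i.+1) /\ cyclic_factor (S i.+1) (S i.+2).
  exact: (hS i.+1).
apply: (resid_fin_cyclic_ext nS cS); last exact: (IHn (S \o succn)).
have [hN _ _ _] := nS.
exact: (polycyclic_subgroup_rank (S := S \o succn) Sn hS' hN (fun x h => h)).
Qed.

Lemma finite_index_rel_fin P : subgroup P -> finite_index P ->
  rel_fin P [set: G].
Proof.
move=> hP /finite_seqP[r hr].
exists [seq xget 1 [set a | left_coset P a = C] | C <- r] => h _.
have rh : left_coset P h \in r.
  suff : [set` r] (left_coset P h) by [].
  by rewrite -hr; exists h.
exists (xget 1 [set a | left_coset P a = left_coset P h]).
  exact: map_f rh.
set a := xget _ _.
have ah : left_coset P a = left_coset P h.
  by apply: (@xgetPex _ 1 [set a | left_coset P a = left_coset P h]); exists h.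
have : left_coset P h h by exists 1; rewrite ?mulg1 //; apply: subgroup1.
by rewrite -ah => -[p Pp <-]; rewrite mulKg.
Qed.

(** A subgroup is generated by its intersection with the polycyclic group [P]
    and by one element of each coset of [P] that it meets. *)
Lemma virtually_polycyclic_rank : virtually_polycyclic G ->
  exists r, forall K, subgroup K -> gen_by K r.
Proof.
move=> [P [hP fP [n [S [S0 Sn _ hS]]]]].
have [s hs] := finite_index_rel_fin hP fP.
exists (n + size s)%N => K hK.
have gKP : gen_by (K `&` P) n.
  apply: (polycyclic_subgroup_rank Sn hS); first exact: subgroupI.
  by rewrite S0 => x [].
pose f a := xget 1 [set k | K k /\ P (a^-1 * k)].
have Kf a : K (f a).
  by rewrite /f; case: xgetP => [k _ [] //|_]; apply: subgroup1.
apply: (@gen_by_cat _ _ _ _ (K `&` P) (generated [set` [seq f a | a <- s]])) => //.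
- by exists [seq f a | a <- s]; rewrite ?size_map.
- by apply: generated_min => // _ /mapP[a _ ->].
set X := _ `|` _.
have gS := generated_subgroup X.
move=> k Kk; have [a as_ Pk] := hs k I.
have [Kfa Pfa] : [set k | K k /\ P (a^-1 * k)] (f a).
  by apply: (@xgetPex _ 1 [set k | K k /\ P (a^-1 * k)]); exists k.
rewrite -(mulVKg (f a) k); apply: (subgroupM gS).
  by apply: sub_generated; right; apply: sub_generated => /=; apply: map_f.
apply: sub_generated; left; split.
  by apply: subgroupM => //; apply: subgroupV.
by have := subgroupM hP (subgroupV hP Pfa) Pk; rewrite !gE.
Qed.

(** The group acts on the cosets of a subgroup of finite index that misses [y],
    and [y] moves the trivial coset. *)
Lemma virtually_polycyclic_resid_fin y : virtually_polycyclic G -> y <> 1 ->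
  exists (Q : finGroupType) (f : G -> Q), {morph f : a b / a * b} /\ f y <> 1.
Proof.
move=> [P [hP fP [n [S [S0 Sn _ hS]]]]] y1.
have fP' := finite_index_rel_fin hP fP.
have [K [hK fK nK]] : exists K, [/\ subgroup K, rel_fin K [set: G] & ~ K y].
  have [Py|nPy] := pselect (P y); last by exists P.
  have [|K [hK _ fK nK]] := polycyclic_resid_fin Sn hS _ y1; first by rewrite S0.
  by exists K; split=> //; rewrite S0 in fK; apply: rel_fin_trans fP'.
have [k [c hc]] := rel_fin_index hK fK.
have {}hc a b : c a = c b <-> K (a^-1 * b) by apply: hc.
pose act g i := if `[< exists a, c a = i >]
  then c (g * xget 1 [set a | c a = i]) else i.
have actE g a : act g (c a) = c (g * a).
  rewrite /act; case: asboolP => [_|[]]; last by exists a.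
  apply/hc; rewrite invgM -mulgA mulKg; apply/hc.
  by apply: (@xgetPex _ 1 [set b | c b = c a]); exists a.
have actD g i : ~ (exists a, c a = i) -> act g i = i.
  by move=> ni; rewrite /act; case: asboolP.
have actM g h i : act (g * h) i = act g (act h i).
  have [[a <-]|ni] := pselect (exists a, c a = i); last by rewrite !actD.
  by rewrite !actE mulgA.
have act1 i : act 1 i = i.
  have [[a <-]|ni] := pselect (exists a, c a = i); last by rewrite !actD.
  by rewrite actE mul1g.
have act_inj g : injective (act g^-1).
  by move=> i j /(congr1 (act g)); rewrite -!actM mulgV !act1.
(* The product of permutations applies its left factor first, which is why the
   inverse appears. *)
exists {perm 'I_k.+1}, (fun g => perm (@act_inj g)); split.
  by move=> a b; apply/permP => i; rewrite permM !permE -actM invgM.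
move=> /permP/(_ (c y)); rewrite permE perm1 actE mulVg => /hc.
by rewrite invg1 mul1g.
Qed.

End Polycyclic.

(** * The universal property of the fundamental group *)

Section FreeProductHom.
Local Open Scope group_scope.
Variables (V E : choiceType) (A : V -> groupType) (Q : groupType).
Variables (phi : forall v, A v -> Q) (psi : E -> Q).
Hypothesis phiM : forall v, {morph @phi v : g h / g * h}.

Definition letter_val (l : letter E A) : Q :=
  match l with
  | inl (existT v g) => phi g
  | inr (e, b) => if b then (psi e)^-1 else psi e
  end.

Definition word_val (w : seq (letter E A)) : Q :=
  foldr (fun l x => letter_val l * x) 1 w.

Lemma word_val_cat u w : word_val (u ++ w) = word_val u * word_val w.
Proof. by elim: u => [|l u IHu] /=; rewrite ?mul1g // IHu mulgA. Qed.

Lemma morph1 (B : groupType) (f : B -> Q) : {morph f : g h / g * h} -> f 1 = 1.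
Proof. by move=> fM; apply: (mulgI (f 1)); rewrite -fM !mulg1. Qed.

Lemma word_val_eq u w : fp_eq u w -> word_val u = word_val w.
Proof.
elim=> {u w} //= [u v w _ -> _ -> //|u1 u2 w1 w2 _ h1 _ h2|v|v g h|e b].
- by rewrite !word_val_cat h1 h2.
- by rewrite (morph1 (@phiM _)) mulg1.
- by rewrite !mulg1 phiM.
- by case: b; rewrite /= mulg1 ?mulgV ?mulVg.
Qed.

Definition fp_hom (x : free_product E A) : Q := word_val (fp_repr x).

Lemma fp_hom_class w : fp_hom (fp_class w) = word_val w.
Proof. exact/word_val_eq/fp_repr_class. Qed.

Lemma fp_homM : {morph fp_hom : x y / x * y}.
Proof.
move=> x y; rewrite -word_val_cat -fp_hom_class.
by congr fp_hom.
Qed.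

Lemma fp_hom_vertex v (g : A v) : fp_hom (fp_vertex E g) = phi g.
Proof. by rewrite fp_hom_class /= mulg1. Qed.

Lemma fp_hom_edge e : fp_hom (fp_edge A e) = psi e.
Proof. by rewrite fp_hom_class /= mulg1. Qed.

End FreeProductHom.

Section MorphFacts.
Local Open Scope group_scope.
Variables (A B : groupType) (f : A -> B).
Hypothesis fM : {morph f : g h / g * h}.

Lemma morphV x : f x^-1 = (f x)^-1.
Proof. by apply: (mulgI (f x)); rewrite -fM !mulgV (morph1 fM). Qed.

End MorphFacts.

Section QuotientHom.
Local Open Scope classical_set_scope.
Local Open Scope group_scope.
Variables (G Q : groupType) (X : set G) (f : G -> Q).
Hypothesis fM : {morph f : g h / g * h}.
Hypothesis fX : forall x, X x -> f x = 1.

Definition q_hom (c : quotient_group X) : Q := f (q_repr c).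

Lemma q_hom_class x : q_hom (q_class X x) = f x.
Proof.
have : normal_closure X ((q_repr (q_class X x))^-1 * x).
  by apply/q_classP; rewrite q_reprK.
move=> /(_ [set y | f y = 1]) h.
have : [set y | f y = 1] ((q_repr (q_class X x))^-1 * x).
  apply: h; split=> //; split=> //.
  - split=> [|y z /= fy fz]; first exact: morph1 fM.
    by rewrite fM (morphV fM) fy fz mulgV.
  - by move=> y z /= fy _; rewrite !fM fy mulg1 -fM mulVg (morph1 fM).
by rewrite /= fM (morphV fM) => /eqP; rewrite mulg_eq1 eqg_inv => /eqP.
Qed.

Lemma q_homM : {morph q_hom : x y / x * y}.
Proof.
move=> a b; rewrite -[a]q_reprK -[b]q_reprK.
rewrite (_ : q_class X (q_repr a) * q_class X (q_repr b) =
             q_class X (q_repr a * q_repr b)); last exact: q_classM.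
by rewrite !q_hom_class fM.
Qed.

End QuotientHom.

Section Pi1.
Local Open Scope classical_set_scope.
Local Open Scope group_scope.
Variables (GG : graph_of_groups) (T : {set edge (graph GG)}).
Local Notation Gamma := (graph GG).
Local Notation E := (edge Gamma).
Local Notation FP := (free_product E (@vgroup GG)).

(** The images in the fundamental group of the elements of the vertex groups and
    of the edges. *)
Definition pv (v : vertex Gamma) (g : vgroup v) : pi1 T :=
  q_class (pi1_relators T) (fp_vertex E g).
Definition pe (e : E) : pi1 T :=
  q_class (pi1_relators T) (fp_edge (@vgroup GG) e).

Lemma q_class_mul (x y : FP) : q_class (pi1_relators T) (x * y) =
  q_class (pi1_relators T) x * q_class (pi1_relators T) y :> pi1 T.
Proof. exact/esym/q_classM. Qed.

Lemma q_class_inv (x : FP) : q_class (pi1_relators T) x^-1 =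
  (q_class (pi1_relators T) x : pi1 T)^-1.
Proof. exact/esym/q_classV. Qed.

Lemma q_class_relator (x : FP) : pi1_relators T x ->
  q_class (pi1_relators T) x = 1 :> pi1 T.
Proof.
move=> hx; apply/q_classP; rewrite mulg1; apply: ncV.
by move=> N [_]; apply.
Qed.

Lemma fp_classM u w : fp_class (u ++ w) = fp_class u * fp_class w :> FP.
Proof.
apply/fp_classP/FpSym; apply: FpCat; exact: fp_repr_class.
Qed.

Lemma pvM v : {morph @pv v : g h / g * h}.
Proof.
move=> g h; rewrite -q_class_mul; congr q_class.
by rewrite -fp_classM; apply/fp_classP/FpSym/FpMul.
Qed.

Lemma pe_rev e : pe e * pe (rev_edge e) = 1.
Proof. by rewrite -q_class_mul q_class_relator //; left; left; exists e. Qed.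

Lemma pe_tree e : e \in T -> pe e = 1.
Proof. by move=> eT; rewrite /pe q_class_relator //; left; right; exists e. Qed.

Lemma pe_conj e (g : egroup e) :
  pv (emap e g) * pe e = pe e * pv (emap (rev_edge e) (to_rev g)).
Proof.
have /q_class_relator : pi1_relators T ((fp_edge _ e)^-1 *
    fp_vertex E (emap e g) * fp_edge _ e *
    (fp_vertex E (emap (rev_edge e) (to_rev g)))^-1).
  by right; exists e, g.
rewrite !q_class_mul !q_class_inv.
by move/divg1_eq => h; rewrite /pv -h !mulgA mulgV mul1g.
Qed.

Lemma pi1_ind (P : pi1 T -> Prop) : P 1 ->
  (forall v (g : vgroup v) x, P x -> P (pv g * x)) ->
  (forall e x, P x -> P (pe e * x)) ->
  (forall e x, P x -> P ((pe e)^-1 * x)) ->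
  forall x, P x.
Proof.
move=> P1 Pv Pe PVe x; rewrite -(q_reprK x) -(fp_reprK (q_repr x)).
elim: (fp_repr (q_repr x)) => [|l w IHw]; first exact: P1.
rewrite -cat1s fp_classM q_class_mul.
case: l => [[v g]|[e [|]]]; [exact: Pv | | exact: Pe].
rewrite (_ : fp_class _ = (fp_edge (@vgroup GG) e)^-1).
  by rewrite q_class_inv; apply: PVe.
apply/esym/mulg1_eq; rewrite /fp_edge -fp_classM.
by apply/fp_classP; apply: (FpInv _ _ false).
Qed.

Lemma pi1_univ (Q : groupType) (phi : forall v, @vgroup GG v -> Q)
    (psi : E -> Q) :
  (forall v, {morph @phi v : g h / g * h}) ->
  (forall e, psi e * psi (rev_edge e) = 1) ->
  (forall e, e \in T -> psi e = 1) ->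
  (forall e (g : egroup e),
     phi _ (emap e g) * psi e = psi e * phi _ (emap (rev_edge e) (to_rev g))) ->
  exists f : pi1 T -> Q, [/\ {morph f : x y / x * y},
    forall v (g : vgroup v), f (pv g) = phi v g & forall e, f (pe e) = psi e].
Proof.
move=> phiM psiV psiT psiJ.
have fM := fp_homM psi phiM.
have fX x : pi1_relators T x -> fp_hom phi psi x = 1.
  case=> [[[e _ <-]|[e eT <-]]|[e [g ->]]].
  - by rewrite fM !(fp_hom_edge psi phiM) psiV.
  - by rewrite (fp_hom_edge psi phiM) psiT.
  - rewrite !fM !(morphV fM) !(fp_hom_edge psi phiM) !(fp_hom_vertex psi phiM).
    by rewrite -(mulgA _ (phi _ _)) psiJ !gE.
exists (q_hom (fp_hom phi psi)); split.
- exact: q_homM.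
- by move=> v g; rewrite (q_hom_class fM fX) (fp_hom_vertex psi phiM).
- by move=> e; rewrite (q_hom_class fM fX) (fp_hom_edge psi phiM).
Qed.

End Pi1.

(** * Potentials on forests *)

Section TreePotential.
Local Open Scope group_scope.
Variables (Gamma : finite_graph).
Implicit Types (T : {set edge Gamma}) (e f : edge Gamma).

Lemma target_rev e : target (rev_edge e) = source e.
Proof. by rewrite /target rev_edgeK. Qed.

(** A path without repeated vertices does not backtrack; the last hypothesis
    covers the first step, after the edge [f]. *)
Lemma reduced_lift T T' f p : T' \subset T ->
  path (adjacent T') (target f) p -> uniq (target f :: p) ->
  rev_edge f \notin T' \/ source f \notin p ->
  exists2 q, path (reduced_step T) f q &
             target (last f q) = last (target f) p.
Proof.
move=> sT; elim: p f => [|x p IHp] f; first by exists [::].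
rewrite [path _ _ _]/= [uniq _]/= => /andP[/existsP[g /and3P[gT /eqP gs /eqP gt]] hp].
move=> /andP[fp up] hf.
have [|||q hq lq] := IHp g; rewrite ?gt //.
  by right; rewrite gs; move: fp; rewrite inE negb_or => /andP[].
exists (g :: q); rewrite /= ?lq ?gt // hq andbT.
rewrite /reduced_step (fintype.subsetP sT _ gT) gs eqxx /=.
apply/eqP => gf; case: hf; first by rewrite -gf gT.
by rewrite inE -gt gf target_rev eqxx.
Qed.

(** Removing an edge [e] of the forest disconnects its ends, so a potential
    for the remaining edges may be changed on the component of one end. *)
Lemma tree_potential (Q : groupType) T (beta : edge Gamma -> Q) :
  (forall e, e \in T -> rev_edge e \in T) -> acyclic T ->
  (forall e, e \in T -> beta (rev_edge e) = (beta e)^-1) ->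
  exists rho : vertex Gamma -> Q,
    forall e, e \in T -> rho (source e) = beta e * rho (target e).
Proof.
have [n] := ubnP #|T|; elim: n T => // n IHn T cT symT acT betaT.
have [->|[e eT]] := set_0Vmem T.
  by exists (fun=> 1) => e; rewrite inE.
pose T' := (T :\ e) :\ rev_edge e.
have sT : T' \subset T by rewrite !subDset subsetU // subsetU ?subxx ?orbT.
have symT' f : f \in T' -> rev_edge f \in T'.
  rewrite !inE => /and3P[fe fre fT]; rewrite symT // andbT.
  have rev_inj := can_inj (@rev_edgeK Gamma).
  by rewrite (inj_eq rev_inj) fre /= -(inj_eq rev_inj) rev_edgeK.
have [||||rho hrho] := IHn T' => //.
- rewrite (leq_trans _ (_ : #|T| <= n)%N) //; apply: proper_card.
  apply/properP; split=> //; exists e => //.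
  by rewrite !inE eqxx andbF.
- move=> f p fT hp; apply: acT; first exact: (fintype.subsetP sT).
  by apply: sub_path hp => x y /and3P[yT h1 h2]; rewrite /reduced_step (fintype.subsetP sT) // h1.
- by move=> f fT; apply: betaT; apply: (fintype.subsetP sT).
pose C := connect (adjacent T') (target e).
have nC : ~~ C (source e).
  apply/negP => /connectP[p hp lp].
  case/shortenP: hp lp => q hq uq _ lq.
  have [|r hr lr] := reduced_lift sT hq uq; first by left; rewrite !inE eqxx.
  by have := acT e r eT hr; rewrite lr lq eqxx.
have Cst f : f \in T' -> C (source f) = C (target f).
  move=> fT; apply/idP/idP => h; apply: connect_trans h (connect1 _).
    by apply/existsP; exists f; rewrite fT !eqxx.
  by apply/existsP; exists (rev_edge f); rewrite symT' // target_rev !eqxx.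
have Ct : C (target e) by apply: connect0.
pose z := (rho (target e))^-1 * (beta e)^-1 * rho (source e).
exists (fun v => if C v then rho v * z else rho v) => f fT.
have [->|fe] := eqVneq f e; first by rewrite (negbTE nC) Ct /z !gE.
have [->|fre] := eqVneq f (rev_edge e).
  by rewrite target_rev -/(target e) (negbTE nC) Ct /z betaT // !gE.
have fT' : f \in T' by rewrite !inE fe fre.
by rewrite Cst // hrho //; case: ifP; rewrite ?mulgA.
Qed.

End TreePotential.

(** * Homomorphisms given on the positive edges *)

Section OrientedHom.
Local Open Scope classical_set_scope.
Local Open Scope group_scope.
Variables (GG : graph_of_groups) (T : {set edge (graph GG)}).
Local Notation Gamma := (graph GG).
Local Notation E := (edge Gamma).

(** The enumeration of the edges chooses one of [e] and [rev_edge e]. *)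
Definition positive (e : E) : bool := (enum_rank e < enum_rank (rev_edge e))%N.

Lemma positive_rev e : positive (rev_edge e) = ~~ positive e.
Proof.
rewrite /positive rev_edgeK; case: ltngtP => // /ord_inj/enum_rank_inj h.
by have := rev_edge_neq e; rewrite h eqxx.
Qed.

Lemma emap_cast (e e' : E) (p : egroup e = egroup e') (g : egroup e) : e = e' ->
  Tagged (@vgroup GG) (emap e' (ecast K (K : groupType) p g)) =
  Tagged (@vgroup GG) (emap e g).
Proof. by move=> ee; case: e' / ee p => p; rewrite (Prop_irrelevance p erefl). Qed.

(** [to_rev] twice is a transport along an equality of [egroup e] with itself
    up to [rev_edgeK], and such a transport is trivial. *)
Lemma emap_rev_rev (e : E) (g : egroup e) :
  Tagged (@vgroup GG) (emap (rev_edge (rev_edge e)) (to_rev (to_rev g))) =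
  Tagged (@vgroup GG) (emap e g).
Proof.
rewrite /to_rev.
set p := esym (egroup_rev e); set q := esym (egroup_rev (rev_edge e)).
have -> : ecast K (K : groupType) q (ecast K (K : groupType) p g) =
          ecast K (K : groupType) (etrans p q) g by case: _ / q.
exact/emap_cast/esym/rev_edgeK.
Qed.

Lemma to_rev_inj (e : E) : injective (@to_rev GG e).
Proof. by move=> g h; rewrite /to_rev; case: _ / (esym _). Qed.

Lemma to_revM (e : E) : {morph @to_rev GG e : g h / g * h}.
Proof. by move=> g h; rewrite /to_rev; case: _ / (esym _). Qed.

(** The relator of [rev_edge e] follows from the one of [e], so only positive
    edges need an image; conjugating by [rho] sends the edges of the tree
    to [1]. *)
Lemma pi1_univ_conj (Q : groupType) (phi : forall v, @vgroup GG v -> Q)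
    (psi : E -> Q) (rho : vertex Gamma -> Q) :
  (forall v, {morph @phi v : g h / g * h}) ->
  (forall e (g : egroup e), positive e ->
     phi _ (emap e g) * psi e = psi e * phi _ (emap (rev_edge e) (to_rev g))) ->
  (forall e, e \in T -> rev_edge e \in T) ->
  (forall e, positive e -> e \in T -> rho (source e) = psi e * rho (target e)) ->
  exists f : pi1 T -> Q, [/\ {morph f : x y / x * y},
    forall v (g : vgroup v), f (pv T g) = (rho v)^-1 * phi v g * rho v &
    forall e, positive e ->
      f (pe T e) = (rho (source e))^-1 * psi e * rho (target e)].
Proof.
move=> phiM psiJ symT hrho.
pose psi' e := if positive e then psi e else (psi (rev_edge e))^-1.
have psiV e : psi' (rev_edge e) = (psi' e)^-1.
  rewrite /psi' positive_rev rev_edgeK; case: (positive e) => //=.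
  by rewrite invgK.
have [|||| f [fM fv fe]] := @pi1_univ GG T Q
    (fun v g => (rho v)^-1 * phi v g * rho v)
    (fun e => (rho (source e))^-1 * psi' e * rho (target e)).
- by move=> v g h; rewrite phiM !gE.
- by move=> e; rewrite psiV target_rev -/(target e) !gE.
- move=> e eT.
  suff -> : rho (source e) = psi' e * rho (target e) by rewrite !gE.
  rewrite /psi'; case: ifPn => pe; first exact: hrho.
  have := hrho _ _ (symT _ eT); rewrite positive_rev => /(_ pe).
  by rewrite target_rev -/(target e) => ->; rewrite !gE.
- move=> e g; rewrite -/(target e) !gE; congr (_ * _).
  rewrite -!mulgA; congr (_ * _).
  rewrite /psi'; case: ifPn => pe; first exact: psiJ.
  have pre : positive (rev_edge e) by rewrite positive_rev.
  have := psiJ _ (to_rev g) pre.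
  pose ph (t : {v & vgroup v}) := phi (tag t) (tagged t).
  have -> : phi _ (emap (rev_edge (rev_edge e)) (to_rev (to_rev g))) =
            phi _ (emap e g).
    exact: (congr1 ph (emap_rev_rev g)).
  move=> h; apply: (mulgI (psi (rev_edge e))); apply: (mulIg (psi (rev_edge e))).
  by rewrite !gE -h.
by exists f; split=> // e pe; rewrite fe /psi' pe.
Qed.

End OrientedHom.

(** * Finite actions of the fundamental group *)

Section FreeTranslations.
Local Open Scope group_scope.

(** Two free actions of the same group on the same finite set, here by left
    translations, have the same number of orbits and so are isomorphic. *)
Lemma free_translations_conj (X : groupType) (B : finGroupType) (i j : X -> B) :
  {morph i : g h / (g * h)%g} -> {morph j : g h / (g * h)%g} ->
  injective i -> injective j ->
  exists beta : {perm B}, forall g b, (beta (i g * b) = j g * beta b)%g.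
Proof.
move=> iM jM i_inj j_inj.
have imG (f : X -> B) : {morph f : g h / g * h} ->
    group_set [set b | `[< exists g, f g = b >]].
  move=> fM; apply/group_setP; split.
    by rewrite !inE; exists 1; apply: morph1.
  move=> x y; rewrite !inE => -[g <-] [h <-]; by exists (g * h).
pose I := Group (imG i iM); pose J := Group (imG j jM).
have Ii g : i g \in I by rewrite !inE; exists g.
have Jj g : j g \in J by rewrite !inE; exists g.
pose lft b := xget 1 [set g | i g = b]%classic.
have lftK b : b \in I -> i (lft b) = b.
  rewrite !inE => hb; exact: (xgetPex _ hb).
have cIJ : #|I| = #|J|.
  have lftJ : {in I &, injective (j \o lft)}.
    by move=> x y xI yI /j_inj h; rewrite -(lftK x) // h lftK.
  rewrite -(card_in_imset lftJ); apply: eq_card => b.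
  apply/imsetP/idP => [[x _ ->]|]; first exact: Jj.
  rewrite !inE => -[g <-]; exists (i g) => //=.
  by congr j; apply: i_inj; rewrite lftK.
have cR : #|rcosets I [set: B]| = #|rcosets J [set: B]|.
  have : (#|I| * #|[set: B]%G : I| = #|J| * #|[set: B]%G : J|)%N.
    by rewrite !Lagrange ?finset.subsetT.
  by rewrite cIJ => /eqP; rewrite eqn_pmul2l ?cardG_gt0 // => /eqP.
(* A bijection from the right cosets of [I] to those of [J]; [f] below extends it
   by [j \o i^-1] from each coset, based at its representative. *)
pose kap C := nth finset.set0 (enum (rcosets J [set: B]))
  (index C (enum (rcosets I [set: B]))).
have rcI b : (I :* b) \in rcosets I [set: B].
  by apply/rcosetsP; exists b; rewrite ?inE.
have kap_lt b : (index (I :* b) (enum (rcosets I [set: B])) < #|rcosets J [set: B]|)%N.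
  by rewrite -cR cardE index_mem mem_enum.
have kapR b : exists c, kap (I :* b) = J :* c.
  have : kap (I :* b) \in rcosets J [set: B].
    by rewrite -mem_enum mem_nth // -cardE.
  by case/rcosetsP => c _ ->; exists c.
have kap_inj b c : kap (I :* b) = kap (I :* c) -> I :* b = I :* c.
  move/eqP; rewrite nth_uniq ?enum_uniq -?cardE // => /eqP h.
  have hb : I :* b \in enum (rcosets I [set: B]) by rewrite mem_enum.
  by rewrite -(nth_index finset.set0 hb) h nth_index // mem_enum.
pose f b := j (lft (b * (repr (I :* b))^-1)) * repr (kap (I :* b)).
have lI b : b * (repr (I :* b))^-1 \in I.
  have : repr (I :* b) \in I :* b by apply: mem_repr (rcoset_refl I b).
  rewrite mem_rcoset => /groupVr; by rewrite invMg invgK.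
have fR b : f b \in kap (I :* b).
  rewrite /f; have [c hc] := kapR b; rewrite hc.
  have : repr (J :* c) \in J :* c by apply: mem_repr (rcoset_refl J c).
  by rewrite !mem_rcoset -mulgA => h; rewrite groupM.
have f_inj : injective f.
  move=> b c hbc.
  have hk : I :* b = I :* c.
    apply: kap_inj; have := fR b; have := fR c; rewrite -hbc.
    have [x ->] := kapR b; have [y ->] := kapR c.
    by move=> /rcoset_eqP <- /rcoset_eqP <-.
  move: hbc; rewrite /f hk => /mulIg/j_inj h.
  by have := lftK _ (lI b); rewrite hk h (lftK _ (lI c)) => /mulIg.
exists (perm f_inj) => g b; rewrite !permE /f rcosetM rcoset_id //.
rewrite mulgA -jM; congr (j _ * _); apply: i_inj.
have hI : i g * b * (repr (I :* b))^-1 \in I by rewrite -mulgA groupM.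
by rewrite iM (lftK _ hI) (lftK _ (lI b)) mulgA.
Qed.

End FreeTranslations.

Section FiniteActions.
Local Open Scope classical_set_scope.
Local Open Scope group_scope.
Variables (GG : graph_of_groups) (T : {set edge (graph GG)}).
Local Notation Gamma := (graph GG).
Local Notation E := (edge Gamma).
Hypothesis symT : forall e, e \in T -> rev_edge e \in T.
Hypothesis acT : acyclic T.
Hypothesis rfV : forall v (y : vgroup v), y <> 1 ->
  exists (Q : finGroupType) (f : @vgroup GG v -> Q),
    {morph f : a b / a * b} /\ f y <> 1.
Hypothesis finE : forall e : E, finite_set [set: egroup e].

(** Extension by the trivial homomorphisms of the other vertex groups. *)
Lemma family_extend (Q : groupType) v (f : @vgroup GG v -> Q) :
  {morph f : a b / a * b} ->
  exists F : forall w, @vgroup GG w -> Q,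
    (forall w, {morph @F w : a b / a * b}) /\ F v =1 f.
Proof.
move=> fM.
exists (fun w x => if pselect (w = v) is left p
   then f (eq_rect w (@vgroup GG) x v p) else 1); split=> [w a b|x].
  by case: pselect => [p|_]; [case: v / p f fM => f; apply | rewrite mulg1].
by case: pselect => // p; rewrite (Prop_irrelevance p erefl).
Qed.

Lemma separating_family (L : seq {v & @vgroup GG v}) :
  (forall t, t \in L -> tagged t <> 1) ->
  exists (B : finGroupType) (F : forall w, @vgroup GG w -> B),
    (forall w, {morph @F w : a b / a * b}) /\
    forall t, t \in L -> F (tag t) (tagged t) <> 1.
Proof.
elim: L => [|[v y] L IHL] hL; first by exists {perm bool}, (fun _ _ => 1); split=> // w a b; rewrite mulg1.
have [|B [F [FM Fn]]] := IHL; first by move=> t tL; apply: hL; rewrite inE tL orbT.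
have [|Q [f [fM fy]]] := @rfV v y.
  by apply: (hL (Tagged (@vgroup GG) y)); rewrite inE eqxx.
have [f' [f'M f'E]] := family_extend fM.
exists (Q * B)%type, (fun w x => (f' w x, F w x)); split=> [w a b|t].
  by rewrite f'M FM.
rewrite inE => /orP[/eqP ->|tL] [h1 h2]; first by apply: fy; rewrite -f'E.
exact: Fn tL h2.
Qed.

(** [pi1 T] acts on a finite set without fixed points for any given finitely
    many nontrivial elements of the vertex groups.  A finite group [B] that
    separates them, and into which the edge groups embed, carries an action of
    each vertex group by translations, and the actions of an edge group coming
    from its two ends are isomorphic; the edge acts as an isomorphism. *)
Lemma pi1_finite_action (L : seq {v & @vgroup GG v}) :
  (forall t, t \in L -> tagged t <> 1) ->
  exists (B : finType) (act : pi1 T -> B -> B) (b0 : B),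
    [/\ forall x, act 1 x = x, forall g h x, act (g * h) x = act g (act h x) &
      forall t, t \in L -> forall x, act (pv T (tagged t)) x <> x].
Proof.
move=> hL.
have fin_seq (e : E) : {s : seq (egroup e) | [set: egroup e] = [set` s]}.
  by apply/cid/finite_seqP/finE.
pose se e := sval (fin_seq e).
have hse e : [set: egroup e] = [set` se e] by exact: svalP (fin_seq e).
have eM (e : E) : {morph emap e : g h / g * h} by move=> g h; apply: gmulfM.
pose LE := [seq Tagged (@vgroup GG) (emap e g)
  | e <- enum E, g <- [seq g <- se e | g != 1]].
have [|B [F [FM Fn]]] := @separating_family (L ++ LE).
  move=> t; rewrite mem_cat => /orP[/hL //|/allpairsPdep[e [g [_ + ->]]]] /=.
  rewrite mem_filter => /andP[/eqP g1 _] h; apply: g1.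
  by apply: (@emap_inj GG e); rewrite h (morph1 (eM _)).
have F_inj e : injective (fun g : egroup e => F _ (emap e g)).
  move=> g h /= gh; apply/eqP; rewrite -divg_eq1; apply: contraT => gh1.
  have /Fn : Tagged (@vgroup GG) (emap e (g * h^-1)) \in L ++ LE.
    rewrite mem_cat; apply/orP; right.
    apply/allpairsPdep; exists e, (g * h^-1); split; rewrite ?mem_enum //.
    rewrite mem_filter gh1 /=.
    suff : [set` se e] (g * h^-1) by [].
    by rewrite -hse.
  case; rewrite /= eM FM gh -FM -eM mulgV.
  by rewrite (morph1 (eM _)) (morph1 (@FM _)).
have /boolp.choice[beta hbeta] : forall e : E, exists be : {perm B}, forall (g : egroup e) b,
    be (F _ (emap e g) * b) = F _ (emap (rev_edge e) (to_rev g)) * be b.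
  move=> e; apply: (free_translations_conj
    (i := fun g : egroup e => F _ (emap e g))
    (j := fun g : egroup e => F _ (emap (rev_edge e) (to_rev g)))).
  - by move=> g h; rewrite gmulfM FM.
  - by move=> g h; rewrite to_revM gmulfM FM.
  - exact: F_inj.
  - by move=> g h /F_inj/to_rev_inj.
pose phi v (g : @vgroup GG v) : {perm B} := perm (mulgI (F v g)^-1).
have phiM v : {morph @phi v : g h / g * h}.
  by move=> g h; apply/permP => b; rewrite permM !permE FM invMg mulgA.
have betaJ e (g : egroup e) : positive e ->
   phi _ (emap e g) * beta e = beta e * phi _ (emap (rev_edge e) (to_rev g)).
  move=> _; apply/permP => b; rewrite !permM !permE.
  by rewrite -!(morphV (@FM _)) -!(morphV (eM _)) hbeta -(morphV (@to_revM _ e)).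
pose beta' e := if positive e then beta e else (beta (rev_edge e))^-1.
have [|rho hrho] := tree_potential (beta := beta') symT acT.
  move=> e _; rewrite /beta' positive_rev rev_edgeK; case: (positive e) => //=.
  by rewrite invgK.
have [|f [fM fv _]] := pi1_univ_conj (rho := rho) phiM betaJ symT.
  by move=> e pe eT; rewrite hrho // /beta' pe.
(* Permutations act on the right, hence the inverse. *)
exists B, (fun g b => (f g)^-1%g b), 1; split.
- by move=> x; rewrite (morph1 fM) invg1 perm1.
- by move=> g h x; rewrite fM invMg permM.
- move=> [v y] tL x /(congr1 (f (pv T y))).
  rewrite permKV /= fv !permM permE => /(congr1 (rho v)^-1) /=.
  rewrite permK => /esym/eqP; rewrite -[X in _ == X]mul1g (inj_eq (mulIg _)).
  rewrite invg_eq1 => /eqP; apply: (Fn (Tagged (@vgroup GG) y) _).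
  by rewrite mem_cat tL.
Qed.

End FiniteActions.

(** * The Bass-Serre tree *)

Record gaction (G : groupType) (A : Type) := GAction {
  gact :> G -> A -> A;
  gact1 : forall x, gact 1%g x = x;
  gactM : forall g h x, gact (g * h)%g x = gact g (gact h x)
}.

Section ActionCancel.
Local Open Scope group_scope.
Variables (G : groupType) (A : Type) (act : gaction G A).

Lemma gactK g : cancel (act g) (act g^-1).
Proof. by move=> a; rewrite -gactM mulVg gact1. Qed.

Lemma gactKV g : cancel (act g^-1) (act g).
Proof. by move=> a; rewrite -gactM mulgV gact1. Qed.

End ActionCancel.

Section Walks.
Variables (V E : Type) (tend : E -> bool -> V).

(** The half-edge [(e, b)] is the edge [e] traversed from [tend e b]. *)
Definition origin (h : E * bool) : V := tend h.1 h.2.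
Definition terminus (h : E * bool) : V := tend h.1 (~~ h.2).

Fixpoint walk (x : V) (s : seq (E * bool)) (y : V) : Prop :=
  if s is h :: s' then origin h = x /\ walk (terminus h) s' y else x = y.

Lemma walk_cat x s t y :
  walk x (s ++ t) y <-> exists2 z, walk x s z & walk z t y.
Proof.
elim: s x => [|h s IHs] x /=; first by split=> [|[z -> //]]; exists x.
split=> [[hx /IHs[z]]|[z [hx hz] hy]]; first by exists z.
by split=> //; apply/IHs; exists z.
Qed.

End Walks.

(** A tree with an action of [G] without inversions.  That every edge [e]
    disconnects the tree is recorded by a function [side e] on the vertices
    whose value changes across [e] and across no other edge. *)
Record gtree (G : groupType) := GTree {
  tvert : choiceType;
  tedge : choiceType;
  vact : gaction G tvert;
  eact : gaction G tedge;
  tend : tedge -> bool -> tvert;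
  tendJ : forall g e b, tend (eact g e) b = vact g (tend e b);
  side : tedge -> tvert -> bool;
  sideP : forall e f, side e (tend f false) (+) side e (tend f true) = (e == f);
  tconn : forall x y, exists s, walk tend x s y
}.

(** The semidirect product of the functions from [X] to the field with two
    elements by [G]; the action is a parameter of the type because the group law
    is inferred from the type. *)
Definition semidirect (G : groupType) (X : Type) (act : gaction G X) : Type :=
  ((X -> bool) * G)%type.

Section Semidirect.
Local Open Scope group_scope.
Variables (G : groupType) (X : Type) (act : gaction G X).
Local Notation semidirect := (semidirect act).
HB.instance Definition _ := Choice.copy semidirect ((X -> bool) * G)%type.

Implicit Types a b c : semidirect.

Definition sd_mul a b : semidirect :=
  (fun x => a.1 x (+) b.1 (act a.2^-1 x), a.2 * b.2).
Definition sd_one : semidirect := (fun=> false, 1).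
Definition sd_inv a : semidirect := (fun x => a.1 (act a.2 x), a.2^-1).

Lemma sd_mulA : associative sd_mul.
Proof.
move=> a b c; congr pair; last exact: mulgA.
by apply/funext => x /=; rewrite addbA invgM gactM.
Qed.

Lemma sd_mul1 : left_id sd_one sd_mul.
Proof.
by case=> a g; congr pair; [apply/funext => x /=; rewrite invg1 gact1 | apply: mul1g].
Qed.

Lemma sd_mulr1 : right_id sd_one sd_mul.
Proof.
by case=> a g; congr pair; [apply/funext => x /=; rewrite addbF | apply: mulg1].
Qed.

Lemma sd_mulV : left_inverse sd_one sd_inv sd_mul.
Proof.
case=> a g; congr pair; last exact: mulVg.
by apply/funext => x /=; rewrite invgK addbb.
Qed.

Lemma sd_mulrV : right_inverse sd_one sd_inv sd_mul.
Proof.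
case=> a g; congr pair; last exact: mulgV.
by apply/funext => x /=; rewrite -gactM mulgV gact1 addbb.
Qed.

HB.instance Definition _ :=
  isGroup.Build semidirect sd_mulA sd_mul1 sd_mulr1 sd_mulV sd_mulrV.

End Semidirect.

Section BassSerre.
Local Open Scope classical_set_scope.
Local Open Scope group_scope.
Variables (GG : graph_of_groups) (T : {set edge (graph GG)}).
Local Notation Gamma := (graph GG).
Local Notation E := (edge Gamma).
Local Notation G := (pi1 T).
Hypothesis treeT : spanning_tree T.

Lemma left_cosetM (C : set G) x y :
  left_coset (left_coset C y) x = left_coset C (x * y).
Proof.
apply/seteqP; split=> [_ [_ [c Cc <-] <-]|_ [c Cc <-]].
  by exists c; rewrite ?mulgA.
by exists (y * c); rewrite ?mulgA //; exists c.
Qed.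

Definition vsub v : set G := range (@pv GG T v).
Definition esub (e : E) : set G := range (fun g : egroup e => pv T (emap e g)).

Lemma vsub_subgroup v : subgroup (vsub v).
Proof.
split=> [|_ _ [g _ <-] [h _ <-]]; first by exists 1 => //; apply: morph1 (@pvM _ _ _).
by exists (g * h^-1) => //; rewrite pvM (morphV (@pvM _ _ _)).
Qed.

Lemma esub_vsub e : esub e `<=` vsub (source e).
Proof. by move=> _ [g _ <-]; exists (emap e g). Qed.

Lemma esub_subgroup e : subgroup (esub e).
Proof.
have eM : {morph emap e : g h / g * h} by move=> g h; apply: gmulfM.
split=> [|_ _ [g _ <-] [h _ <-]].
  by exists 1 => //; rewrite (morph1 eM); apply: morph1 (@pvM _ _ _).
exists (g * h^-1) => //.
by rewrite eM (morphV eM) pvM (morphV (@pvM _ _ _)).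
Qed.

(** The vertices and the edges of the tree are the cosets of the vertex groups
    and those of the edge groups of the positive edges. *)
Definition bs_vert : Type :=
  {t : vertex Gamma * set G | exists g, t.2 = left_coset (vsub t.1) g}.
Definition bs_edge : Type :=
  {t : E * set G | positive t.1 /\ exists g, t.2 = left_coset (esub t.1) g}.
HB.instance Definition _ := gen_eqMixin bs_vert.
HB.instance Definition _ := gen_choiceMixin bs_vert.
HB.instance Definition _ := gen_eqMixin bs_edge.
HB.instance Definition _ := gen_choiceMixin bs_edge.

Lemma bs_vert_inj (s t : bs_vert) : sval s = sval t -> s = t.
Proof. by case: s t => [s hs] [t ht] /= st; apply: eq_exist. Qed.

Lemma bs_edge_inj (s t : bs_edge) : sval s = sval t -> s = t.
Proof. by case: s t => [s hs] [t ht] /= st; apply: eq_exist. Qed.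

Definition mkv v g : bs_vert := exist _ (v, left_coset (vsub v) g) (ex_intro _ g erefl).
Definition mke e (pe : positive e) g : bs_edge :=
  exist _ (e, left_coset (esub e) g) (conj pe (ex_intro _ g erefl)).

Lemma bs_vertP (t : bs_vert) : exists v g, t = mkv v g.
Proof. by case: t => [[v C] [g Cg]]; exists v, g; apply: bs_vert_inj; rewrite /= -Cg. Qed.

Lemma bs_edgeP (t : bs_edge) : exists e (pe : positive e) g, t = mke pe g.
Proof.
case: t => [[e C] [pe [g Cg]]]; exists e, pe, g; apply: bs_edge_inj.
by rewrite /= -Cg.
Qed.

Lemma left_coset_eq (A : set G) g h : subgroup A ->
  (left_coset A g = left_coset A h <-> A (g^-1 * h)).
Proof.
move=> sA; split=> [gh|Agh].
  have : left_coset A h h by exists 1; rewrite ?mulg1 //; apply: subgroup1.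
  by rewrite -gh => -[a Aa <-]; rewrite mulKg.
apply/seteqP; split=> _ [a Aa <-].
  exists (h^-1 * g * a); last by rewrite !mulgA mulgV mul1g.
  by apply: subgroupM => //; have := subgroupV sA Agh; rewrite invgM invgK.
by exists (g^-1 * h * a); [apply: subgroupM | rewrite !mulgA mulgV mul1g].
Qed.

Lemma mkv_eq v g h : mkv v g = mkv v h <-> vsub v (g^-1 * h).
Proof.
rewrite -(left_coset_eq _ _ (@vsub_subgroup v)); split=> [[]//|gh].
by apply: bs_vert_inj; rewrite /= gh.
Qed.

Lemma mke_eq e (pe : positive e) g h : mke pe g = mke pe h <-> esub e (g^-1 * h).
Proof.
rewrite -(left_coset_eq _ _ (@esub_subgroup e)); split=> [[]//|gh].
by apply: bs_edge_inj; rewrite /= gh.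
Qed.

Lemma bs_vact_subproof x (t : bs_vert) :
  exists g, left_coset (sval t).2 x = left_coset (vsub (sval t).1) g.
Proof. by case: t => [[v C] /= [g ->]]; exists (x * g); rewrite left_cosetM. Qed.

Definition bs_vact_fun x (t : bs_vert) : bs_vert :=
  exist _ ((sval t).1, left_coset (sval t).2 x) (bs_vact_subproof x t).

Lemma bs_vact_mkv x v g : bs_vact_fun x (mkv v g) = mkv v (x * g).
Proof. by apply: bs_vert_inj; rewrite /= left_cosetM. Qed.

Lemma bs_eact_subproof x (t : bs_edge) : positive (sval t).1 /\
  exists g, left_coset (sval t).2 x = left_coset (esub (sval t).1) g.
Proof.
by case: t => [[v C] /= [pe [g ->]]]; split=> //; exists (x * g); rewrite left_cosetM.
Qed.

Definition bs_eact_fun x (t : bs_edge) : bs_edge :=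
  exist _ ((sval t).1, left_coset (sval t).2 x) (bs_eact_subproof x t).

Lemma bs_eact_mke x e (pe : positive e) g :
  bs_eact_fun x (mke pe g) = mke pe (x * g).
Proof. by apply: bs_edge_inj; rewrite /= left_cosetM. Qed.

Lemma bs_vact1 t : bs_vact_fun 1 t = t.
Proof. by have [v [g ->]] := bs_vertP t; rewrite bs_vact_mkv mul1g. Qed.

Lemma bs_vactM x y t : bs_vact_fun (x * y) t = bs_vact_fun x (bs_vact_fun y t).
Proof. by have [v [g ->]] := bs_vertP t; rewrite !bs_vact_mkv mulgA. Qed.

Lemma bs_eact1 t : bs_eact_fun 1 t = t.
Proof. by have [e [pe [g ->]]] := bs_edgeP t; rewrite bs_eact_mke mul1g. Qed.

Lemma bs_eactM x y t : bs_eact_fun (x * y) t = bs_eact_fun x (bs_eact_fun y t).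
Proof. by have [e [pe [g ->]]] := bs_edgeP t; rewrite !bs_eact_mke mulgA. Qed.

Definition bs_vact := GAction bs_vact1 bs_vactM.
Definition bs_eact := GAction bs_eact1 bs_eactM.

Lemma bs_eactKV x t : bs_eact x (bs_eact_fun x^-1 t) = t.
Proof. by rewrite -[RHS]bs_eact1 -(mulgV x) bs_eactM. Qed.

(** A chosen element of a coset. *)
Definition set_point (C : set G) : G := xget 1 C.

Lemma bs_edge_pointP (t : bs_edge) (pt := proj1 (svalP t)) :
  t = mke pt (set_point (sval t).2).
Proof.
apply: bs_edge_inj => /=; rewrite [LHS]surjective_pairing; congr pair.
case: t {pt} => [[e C] /= [pe [g ->]]].
apply/(left_coset_eq _ _ (@esub_subgroup e)).
have [a Aa <-] : left_coset (esub e) g (set_point (left_coset (esub e) g)).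
  apply: xgetPex; exists g; exists 1; rewrite ?mulg1 //.
  exact: subgroup1 (@esub_subgroup e).
by rewrite mulKg.
Qed.

Definition bs_end (t : bs_edge) (b : bool) : bs_vert :=
  let: (e, C) := sval t in
  if b then mkv (target e) (set_point C * pe T e)
  else mkv (source e) (set_point C).

Lemma esub_conj e a : esub e a -> vsub (target e) ((pe T e)^-1 * a * pe T e).
Proof.
case=> g _ <-; exists (emap (rev_edge e) (to_rev g)) => //.
by rewrite -mulgA pe_conj mulKg.
Qed.

Lemma bs_end_mke e (p : positive e) g b : bs_end (mke p g) b =
  if b then mkv (target e) (g * pe T e) else mkv (source e) g.
Proof.
have h0 : mke p g = mke p (set_point (sval (mke p g)).2).
  by have := bs_edge_pointP (mke p g); rewrite (bool_irrelevance (proj1 _) p).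
have := subgroupV (@esub_subgroup e) ((mke_eq _ _ _).1 h0).
rewrite /= invgM invgK.
rewrite /bs_end /=; set c := set_point _ => h.
case: b; apply/mkv_eq; last exact: esub_vsub.
by have := esub_conj h; rewrite !gE.
Qed.

Lemma bs_endJ x t b : bs_end (bs_eact x t) b = bs_vact x (bs_end t b).
Proof.
have [e [p [g ->]]] := bs_edgeP t.
rewrite [bs_eact _ _]bs_eact_mke !bs_end_mke.
by case: b; rewrite [RHS]bs_vact_mkv // mulgA.
Qed.

(** The vertices that can be reached from the base point are stable under the
    generators of the group: a vertex group fixes a vertex of the lift of the
    spanning tree, and an edge moves such a vertex to a neighbour of another. *)
Lemma bs_connected x y : exists s, walk bs_end x s y.
Proof.
have [symT connT acT] := treeT.
pose R x y := exists s, walk bs_end x s y.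
have Rtrans x1 x2 x3 : R x1 x2 -> R x2 x3 -> R x1 x3.
  by move=> [s hs] [t ht]; exists (s ++ t); apply/walk_cat; exists x2.
have Rsym x1 x2 : R x1 x2 -> R x2 x1.
  case=> s; elim: s x1 => [|h s IHs] x1 /=; first by move=> ->; exists [::].
  move=> [<- /IHs h2]; apply: Rtrans h2 _; exists [:: (h.1, ~~ h.2)].
  by rewrite /= /origin /terminus /= negbK.
have RJ g x1 x2 : R x1 x2 -> R (bs_vact g x1) (bs_vact g x2).
  case=> s hs; exists [seq (bs_eact g h.1, h.2) | h <- s].
  elim: s x1 hs => [|h s IHs] x1 /=; first by move->.
  by move=> [<- /IHs]; rewrite /origin /terminus /= !bs_endJ.
have Redge e g : R (mkv (source e) g) (mkv (target e) (g * pe T e)).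
  have [p|p] := boolP (positive e).
    by exists [:: (mke p g, false)]; rewrite /= /origin /terminus /= !bs_end_mke.
  have p' : positive (rev_edge e) by rewrite positive_rev.
  exists [:: (mke p' (g * pe T e), true)].
  by rewrite /= /origin /terminus /= !bs_end_mke target_rev -mulgA pe_rev mulg1.
have [v0 _] : exists v : vertex Gamma, true.
  by have /card_gt0P[v _] := vertex_gt0 Gamma; exists v.
have Rbase v w : R (mkv v 1) (mkv w 1).
  have /connectP[p hp ->] := connT v w.
  elim: p v hp => [|u p IHp] v /=; first by exists [::].
  case/andP => /existsP[e /and3P[eT /eqP <- /eqP <-]] /IHp; apply: Rtrans.
  by have := Redge e 1; rewrite mul1g (pe_tree eT).
have RT g : R (mkv v0 1) (mkv v0 g).
  have RM a z : R (mkv v0 1) (mkv v0 a) -> R (mkv v0 1) (mkv v0 z) ->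
      R (mkv v0 1) (mkv v0 (a * z)).
    move=> ha hz; apply: Rtrans ha _.
    by have := RJ a _ _ hz; rewrite ![bs_vact _ _]bs_vact_mkv mulg1.
  have RV a : R (mkv v0 1) (mkv v0 a) -> R (mkv v0 1) (mkv v0 a^-1).
    move=> ha; apply: Rsym; have := RJ a^-1 _ _ ha.
    by rewrite ![bs_vact _ _]bs_vact_mkv mulg1 mulVg.
  have Rpe e : R (mkv v0 1) (mkv v0 (pe T e)).
    apply: (Rtrans _ _ _ (Rbase _ (source e))); apply: (Rtrans _ _ _ (Redge _ _)).
    have := RJ (pe T e) _ _ (Rbase (target e) v0).
    by rewrite ![bs_vact _ _]bs_vact_mkv mul1g mulg1.
  elim/pi1_ind: g => [|v a z hz|e z hz|e z hz]; first by exists [::].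
  - apply: RM => //; apply: (Rtrans _ _ _ (Rbase _ v)).
    have := RJ (pv T a) _ _ (Rbase v v0); rewrite ![bs_vact _ _]bs_vact_mkv mulg1.
    suff -> : mkv v (pv T a) = mkv v 1 by [].
    by apply/mkv_eq; rewrite mulg1; apply: subgroupV (vsub_subgroup _) _; exists a.
  - exact: RM.
  - by apply: RM => //; apply: RV.
have R0 t : R (mkv v0 1) t.
  have [v [g ->]] := bs_vertP t; apply: Rtrans (RT g) _.
  by have := RJ g _ _ (Rbase v0 v); rewrite ![bs_vact _ _]bs_vact_mkv mulg1.
exact: Rtrans (Rsym _ _ (R0 x)) (R0 y).
Qed.

(** Sending the vertex groups to themselves and an edge [e] to the pair of the
    indicator function of the edge [mke p 1] and of [pe T e] respects the
    relators, because the edge group fixes [mke p 1].  The first component of the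
    resulting homomorphism records, modulo 2, the edges between the base point
    and its image, and this extends to all vertices. *)
Lemma bs_side : exists sd : bs_edge -> bs_vert -> bool,
  forall e f, sd e (bs_end f false) (+) sd e (bs_end f true) = (e == f).
Proof.
have [symT connT acT] := treeT.
pose Q : groupType := semidirect bs_eact.
pose phi v (g : @vgroup GG v) : Q := (fun=> false, pv T g).
pose psi (e : E) : Q := (fun t => `[< exists p : positive e, t = mke p 1 >], pe T e).
have phiM v : {morph @phi v : g h / g * h}.
  move=> g h; congr pair; last exact: pvM.
have psiJ e (g : egroup e) : positive e ->
   phi _ (emap e g) * psi e = psi e * phi _ (emap (rev_edge e) (to_rev g)).
  move=> p; congr pair; last exact: pe_conj.
  apply/funext => t /=; rewrite addbF; apply: asbool_equiv_eq.
  have fixe (q : positive e) : mke q (pv T (emap e g)) = mke q 1.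
    apply/mke_eq; rewrite mulg1.
    have h : esub e (pv T (emap e g)) by exists g.
    exact: (subgroupV (@esub_subgroup e) h).
  split=> [[q h]|[q ->]]; exists q.
    rewrite -fixe -[LHS](bs_eactKV (pv T (emap e g))) h.
    by rewrite [bs_eact _ _]bs_eact_mke mulg1.
  by rewrite -{1}fixe [bs_eact_fun _ _]bs_eact_mke mulVg.
pose beta e := if positive e then psi e else (psi (rev_edge e))^-1.
have [|gam hgam] := tree_potential (beta := beta) symT acT.
  move=> e _; rewrite /beta positive_rev rev_edgeK; case: (positive e) => //=.
  by rewrite invgK.
pose rho v : Q := ((gam v).1, 1).
have [|f [fM fv fe]] := pi1_univ_conj (rho := rho) phiM psiJ symT.
  move=> e p eT; have := congr1 fst (hgam e eT); rewrite /beta p => h.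
  congr pair; last by rewrite /= (pe_tree eT) mulg1.
  exact: h.
have Q2M (a b : Q) : (a * b).2 = a.2 * b.2 by [].
have Q2V (a : Q) : a^-1.2 = a.2^-1 by [].
have f2e e : (f (pe T e)).2 = pe T e.
  have pos e' : positive e' -> (f (pe T e')).2 = pe T e'.
    by move=> p; rewrite fe // !Q2M Q2V /= invg1 mul1g mulg1.
  have [|p] := boolP (positive e); first exact: pos.
  have -> : pe T e = (pe T (rev_edge e))^-1.
    by apply/esym/mulg1_eq; rewrite -{2}[e]rev_edgeK pe_rev.
  by rewrite (morphV fM) Q2V pos // positive_rev.
have f2 x : (f x).2 = x.
  elim/pi1_ind: x => [|v g x hx|e x hx|e x hx].
  - by rewrite (morph1 fM).
  - by rewrite fM Q2M hx fv !Q2M Q2V /= invg1 mul1g mulg1.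
  - by rewrite fM Q2M hx f2e.
  - by rewrite fM Q2M hx (morphV fM) Q2V f2e.
(* The first component of [F x v] depends only on the coset of [x] modulo the
   vertex group of [v]; it is the colouring at the vertex [mkv v x]. *)
pose F x v : Q := f x * (rho v)^-1.
have FM x v (g : vgroup v) t : (F (x * pv T g) v).1 t = (F x v).1 t.
  rewrite /F fM fv -(mulgA (f x)) mulgK mulgA.
  by rewrite {1}/mul /= addbF.
pose sd t (w : bs_vert) := (F (set_point (sval w).2) (sval w).1).1 t.
have sdE t v g : sd t (mkv v g) = (F g v).1 t.
  rewrite /sd /=; set c := set_point _.
  have [_ [a _ <-] <-] : left_coset (vsub v) g c.
    apply: xgetPex; exists g; exists 1; rewrite ?mulg1 //.
    exact: subgroup1 (@vsub_subgroup v).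
  exact: FM.
exists sd => t w; have [e [p [g ->]]] := bs_edgeP w.
rewrite !bs_end_mke !sdE.
have -> : F (g * pe T e) (target e) = F g (source e) * psi e.
  by rewrite /F fM fe // -(mulgA (f g)) mulgK mulgA.
have -> : (F g (source e) * psi e : Q).1 t = (F g (source e)).1 t (+)
   `[< exists p : positive e, bs_eact_fun g^-1 t = mke p 1 >].
  by rewrite {1}/mul /= f2 invg1 mulg1.
rewrite addbA addbb addFb; apply/asboolP/eqP => [[q h]|->].
  rewrite -[LHS](bs_eactKV g) h [bs_eact _ _]bs_eact_mke mulg1.
  by congr mke; apply: bool_irrelevance.
by exists p; rewrite bs_eact_mke mulVg.
Qed.

Definition bs_tree : gtree G :=
  let sd := cid bs_side in GTree bs_endJ (svalP sd) bs_connected.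

End BassSerre.

(** * Geodesics, and the subtree spanned by an orbit *)

Section TreeGeometry.
Local Open Scope classical_set_scope.
Local Open Scope group_scope.
Variables (G : groupType) (X : gtree G).
Local Notation V := (tvert X).
Local Notation E := (tedge X).
Local Notation org := (origin (@tend G X)).
Local Notation trm := (terminus (@tend G X)).
Local Notation walk := (walk (@tend G X)).
Implicit Types (x y z u v w : V) (e f : E) (h k l : E * bool).
Implicit Types (s t r : seq (E * bool)).

(** The edge [e] lies between [x] and [y]. *)
Definition sep e x y : bool := side e x (+) side e y.

Lemma sep_refl e x : sep e x x = false.
Proof. exact: addbb. Qed.

Lemma sep_sym e x y : sep e x y = sep e y x.
Proof. exact: addbC. Qed.

Lemma sep_add e x y z : sep e x z = sep e x y (+) sep e y z.
Proof. by rewrite /sep addbA addbK. Qed.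

Lemma sep_half e h : sep e (org h) (trm h) = (e == h.1).
Proof. by case: h => f [|]; rewrite /sep /origin /terminus /= -sideP // addbC. Qed.

Lemma walk_sep e x s y : walk x s y -> sep e x y = odd (count_mem e (unzip1 s)).
Proof.
elim: s x => [|h s IHs] x /=; first by move=> ->; apply: sep_refl.
move=> [<- /IHs hs]; rewrite (sep_add _ _ (trm h)) hs sep_half oddD.
by rewrite eq_sym; case: (_ == _).
Qed.

Definition geod x s y : Prop := walk x s y /\ uniq (unzip1 s).

Lemma geod_sep e x s y : geod x s y -> sep e x y = (e \in unzip1 s).
Proof. by case=> /walk_sep -> us; rewrite count_uniq_mem //; case: (_ \in _). Qed.

(** A walk that crosses an edge twice can be shortened. *)
Lemma geod_exists x y : exists s, geod x s y.
Proof.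
have [s0 hs0] := tconn x y.
have [n] := ubnP (size s0); elim: n s0 hs0 => // n IHn s hs sn.
have [us|nus] := boolP (uniq (unzip1 s)); first by exists s.
suff [a [h [b [k [c [sE hk]]]]]] : exists a h b k c,
    s = a ++ h :: b ++ k :: c /\ h.1 = k.1.
  move: hs; rewrite sE => /walk_cat[z hz /= [hzh]].
  move=> /walk_cat[z' hb /= [hz'k hc]].
  have [hk2|hk2] := eqVneq h.2 k.2.
    have {}hk : h = k by case: h k hk hk2 {sE hzh hb hz'k hc} => ? ? [? ?] /= -> ->.
    apply: (IHn (a ++ k :: c)); last first.
      by move: sn; rewrite sE !size_cat /= size_cat /=; lia.
    by apply/walk_cat; exists z => //=; rewrite -{1}hk.
  apply: (IHn (a ++ c)); last first.
    by move: sn; rewrite sE !size_cat /= size_cat /=; lia.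
  apply/walk_cat; exists z => //; suff -> : z = trm k by [].
  rewrite -hzh.
  by rewrite /origin /terminus hk; move: hk2; case: h.2; case: k.2.
elim: {IHn hs sn} s nus => //= h s IHs; rewrite negb_and negbK.
case/orP => [/mapP[k]|/IHs[a [h' [b [k [c [-> hk]]]]]]].
  by move=> /splitPr[b c] hk; exists [::], h, b, k, c.
by exists (h :: a), h', b, k, c.
Qed.

Lemma sep_eq x y : (forall e, ~~ sep e x y) -> x = y.
Proof.
move=> hxy; have [[//|h s] hs] := geod_exists x y; first by case: hs.
by have := hxy h.1; rewrite (geod_sep _ hs) inE eqxx.
Qed.

(** There are no loops, so the origin determines the direction. *)
Lemma half_edge_eq h k : h.1 = k.1 -> org h = org k -> h = k.
Proof.
case: h k => e b [f c] /= <- hk; congr pair; apply/eqP; apply: contraT => bc.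
have := sep_half e (e, b); rewrite eqxx /= hk.
suff -> : trm (e, b) = org (e, c) by rewrite sep_refl.
by move: bc; rewrite /origin /terminus /=; case: (b); case: (c).
Qed.

Lemma half_end h k : h.1 = k.1 -> org k = org h \/ org k = trm h.
Proof.
case: h k => e b [f c] /= <-; rewrite /origin /terminus /=.
by case: (b); case: (c); auto.
Qed.

Lemma geod_cat x s t y : geod x (s ++ t) y ->
  exists z, [/\ geod x s z, geod z t y & ~~ has (mem (unzip1 s)) (unzip1 t)].
Proof.
case=> /walk_cat[z hs ht]; rewrite /unzip1 map_cat cat_uniq => /and3P[us hst ut].
by exists z.
Qed.

(** If [h] starts at [x] and separates [x] from [y], a geodesic that leaves [x]
    by another edge would have to come back to [x] to cross [h]. *)
Lemma geod_head x h k t y : geod x (k :: t) y -> org h = x -> sep h.1 x y ->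
  h = k.
Proof.
move=> gk hx; rewrite (geod_sep _ gk) /= inE => /orP[/eqP hk|].
  by apply: half_edge_eq => //; case: gk => -[-> _].
move=> /mapP[l lt hl].
case/splitPr: lt gk => a b; rewrite -cat_cons => gk.
have [z [ga gb nab]] := geod_cat gk.
have zl : org l = z by case: gb => -[].
have hka : h.1 \notin unzip1 (k :: a).
  by apply: contra nab => ha; rewrite /= hl in ha; apply/hasP; exists l.1; rewrite ?inE ?eqxx.
have nz : ~~ sep h.1 x z by rewrite (geod_sep _ ga).
have [lh|lh] := half_end hl.
  have : sep k.1 x x by rewrite -{2}hx -lh zl (geod_sep _ ga) inE eqxx.
  by rewrite sep_refl.
by move: nz; rewrite -zl lh -hx sep_half eqxx.
Qed.

(** Geodesics are unique, as the first half-edge is forced at each step. *)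
Lemma geod_inj x s t y : geod x s y -> geod x t y -> s = t.
Proof.
elim: s x t => [|h s IHs] x [|k t] gs gt //.
- case: gs gt => /= -> _ gt; have := sep_refl k.1 y.
  by rewrite (geod_sep _ gt) inE eqxx.
- case: gt gs => /= -> _ gs; have := sep_refl h.1 y.
  by rewrite (geod_sep _ gs) inE eqxx.
have hk : h = k.
  apply: geod_head gt _ _; first by case: gs => -[].
  by rewrite (geod_sep _ gs) inE eqxx.
congr cons => //; subst k; case: gs => -[_ ws] /andP[_ us].
by case: gt => -[_ wt] /andP[_ ut]; apply: (IHs (trm h)).
Qed.

Definition hact : G -> E * bool -> E * bool := fun g h => (eact X g h.1, h.2).

Lemma hact1 h : hact 1 h = h.
Proof. by case: h => e b; rewrite /hact gact1. Qed.

Lemma hactM g g' h : hact (g * g') h = hact g (hact g' h).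
Proof. by rewrite /hact gactM. Qed.

Definition half_action := GAction hact1 hactM.

Lemma orgJ g h : org (half_action g h) = vact X g (org h).
Proof. exact: tendJ. Qed.

Lemma trmJ g h : trm (half_action g h) = vact X g (trm h).
Proof. exact: tendJ. Qed.

Lemma walkJ g x s y : walk x s y ->
  walk (vact X g x) [seq half_action g h | h <- s] (vact X g y).
Proof.
elim: s x => [|h s IHs] x /=; first by move->.
by move=> [<- /IHs]; rewrite orgJ trmJ.
Qed.

(** [sep] is the parity of the crossings along a walk, so it is invariant
    although [side] is invariant up to complement only. *)
Lemma sepJ g e x y : sep (eact X g e) (vact X g x) (vact X g y) = sep e x y.
Proof.
have [s [ws us]] := geod_exists x y.
rewrite (walk_sep _ ws) (walk_sep _ (walkJ g ws)) /unzip1 -map_comp.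
rewrite (eq_map (_ : _ =1 eact X g \o fst)) // map_comp count_map.
by congr odd; apply: eq_count => f /=; rewrite (can_eq (gactK (eact X) g)).
Qed.

Lemma geodJ g x s y : geod x s y ->
  geod (vact X g x) [seq half_action g h | h <- s] (vact X g y).
Proof.
case=> ws us; split; first exact: walkJ.
rewrite /unzip1 -map_comp (eq_map (_ : _ =1 eact X g \o fst)) // map_comp.
by rewrite map_inj_uniq //; apply: can_inj (gactK (eact X) g).
Qed.

Section Hull.
Variables (p : V) (H : set G).
Hypothesis sH : subgroup H.

(** The edges of the subtree spanned by the orbit of [p] under [H]. *)
Definition hull_edge e : Prop :=
  exists a b, [/\ H a, H b & sep e (vact X a p) (vact X b p)].

Definition in_orbit v : Prop := exists2 a, H a & v = vact X a p.

Definition in_hull v : Prop :=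
  in_orbit v \/ exists2 h, org h = v & hull_edge h.1.

Lemma hull_edgeJ g e : H g -> hull_edge e -> hull_edge (eact X g e).
Proof.
move=> Hg [a [b [Ha Hb hab]]]; exists (g * a), (g * b).
by split; rewrite ?gactM ?sepJ //; apply: subgroupM.
Qed.

Lemma in_orbitJ g v : H g -> in_orbit v -> in_orbit (vact X g v).
Proof. by move=> Hg [a Ha ->]; exists (g * a); rewrite ?gactM //; apply: subgroupM. Qed.

Lemma in_hullJ g v : H g -> in_hull v -> in_hull (vact X g v).
Proof.
move=> Hg [hv|[h <- hh]]; [left|right; exists (half_action g h)].
- exact: in_orbitJ.
- exact: orgJ.
- exact: hull_edgeJ.
Qed.

(** Of the two orbit points that [h.1] separates, one is on the side of the
    origin of [h]. *)
Lemma hull_half h : hull_edge h.1 -> exists q q',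
  [/\ in_orbit q, in_orbit q', ~~ sep h.1 (org h) q & sep h.1 (org h) q'].
Proof.
move=> [a [b [Ha Hb]]]; rewrite (sep_add _ _ (org h)) [sep _ _ (org h)]sep_sym.
have oa : in_orbit (vact X a p) by exists a.
have ob : in_orbit (vact X b p) by exists b.
case ha: (sep h.1 (org h) (vact X a p)); case hb: (sep h.1 (org h) (vact X b p)) => // _.
  by exists (vact X b p), (vact X a p); rewrite ha hb.
by exists (vact X a p), (vact X b p); rewrite ha hb.
Qed.

Lemma hull_edge_orbit e q q' : in_orbit q -> in_orbit q' -> sep e q q' ->
  hull_edge e.
Proof. by move=> [a Ha ->] [b Hb ->] hab; exists a, b. Qed.

(** Outside the orbit the subtree has no leaf: if [h] separates the orbit points
    [q] and [q'], the geodesic from its origin to the nearer one, [q], leaves by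
    another edge, which separates [q] from [q'] too. *)
Lemma hull_second h : hull_edge h.1 -> ~ in_orbit (org h) ->
  exists k, [/\ org k = org h, k.1 != h.1 & hull_edge k.1].
Proof.
move=> /hull_half[q [q' [oq oq' hq hq']]] nv.
have [[|k t] gk] := geod_exists (org h) q.
  by case: gk => /= hq0; case: nv; rewrite hq0.
have kv : org k = org h by case: gk => -[].
have kq : sep k.1 (org h) q by rewrite (geod_sep _ gk) inE eqxx.
have kh : k.1 != h.1 by apply: contraNneq hq => <-.
exists k; split=> //; apply: (hull_edge_orbit oq oq').
rewrite (sep_add _ _ (org h)) sep_sym kq /=.
apply/negP => kq'.
have [[|l r] gl] := geod_exists (org h) q'.
  by case: gl kq' => /= <-; rewrite sep_refl.
have := geod_head gl kv kq'; rewrite -(geod_head gl erefl hq').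
by move=> e; rewrite e eqxx in kh.
Qed.

(** The convexity of the subtree: its vertices lie on every side that contains
    the whole orbit. *)
Lemma in_hull_side v e : in_hull v -> exists2 q, in_orbit q & ~~ sep e v q.
Proof.
case=> [ov|[h <- /hull_half[q [q' [oq oq' hq hq']]]]].
  by exists v => //; rewrite sep_refl.
have [eq|eq] := boolP (sep e (org h) q); last by exists q.
have [eq'|eq'] := boolP (sep e (org h) q'); last by exists q'.
have [r gr] := geod_exists q q'.
have : sep h.1 q q' by rewrite (sep_add _ _ (org h)) [sep _ q _]sep_sym (negbTE hq).
rewrite (geod_sep _ gr) => /mapP[l lr hl].
case/splitPr: lr gr => a b gr.
have [z [ga gb nab]] := geod_cat gr.
have zl : org l = z by case: gb => -[].
have nz : ~~ sep h.1 q z.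
  rewrite (geod_sep _ ga); apply: contra nab => ha.
  by rewrite hl in ha; apply/hasP; exists l.1; rewrite ?inE ?eqxx.
have [lh|lh] := half_end hl; last first.
  move: nz; rewrite -zl lh (sep_add _ _ (org h)) [sep _ q _]sep_sym (negbTE hq).
  by rewrite sep_half eqxx.
have : sep e q q'.
  rewrite (geod_sep _ gr) /unzip1 map_cat mem_cat.
  by rewrite -(geod_sep e ga) -zl lh sep_sym eq.
by rewrite (sep_add _ _ (org h)) [sep _ q _]sep_sym eq eq'.
Qed.

Lemma in_hull_sep u w e : in_hull u -> in_hull w -> sep e u w -> hull_edge e.
Proof.
move=> /(@in_hull_side u e)[q oq uq] /(@in_hull_side w e)[q' oq' wq'] uw.
apply: (hull_edge_orbit oq oq').
rewrite (sep_add _ _ u) (sep_add _ u w) uw [sep _ q _]sep_sym (negbTE uq).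
by rewrite (negbTE wq').
Qed.

(** An edge between [p] and the image of [p] by a product of generators lies
    between the images by two consecutive partial products, so it is a translate
    of an edge between [p] and its image by a generator. *)
Lemma hull_edge_cofinite (gs : seq G) : H = generated [set` gs] ->
  exists L : seq E, forall e, hull_edge e ->
    exists g f, [/\ H g, f \in L & e = eact X g f].
Proof.
move=> Hgs.
have /boolp.choice[geo hgeo] : forall a, exists s, geod p s (vact X a p).
  by move=> a; apply: geod_exists.
pose L := flatten [seq unzip1 (geo a) | a <- gs].
exists L => e [a [b [Ha Hb hab]]].
pose P := [set x | H x /\ forall e, sep e p (vact X x p) ->
                   exists g f, [/\ H g, f \in L & e = eact X g f]].
have {}hab : sep (eact X a^-1 e) p (vact X (a^-1 * b) p).
  by rewrite -(sepJ a) gactKV gactM gactKV.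
suff PH : H `<=` P.
  have /PH[_ /(_ _ hab)[g [f [Hg fL ef]]]] : H (a^-1 * b).
    by apply: subgroupM => //; apply: subgroupV.  exists (a * g), f; split=> //.
    exact: subgroupM.
  by rewrite gactM -ef gactKV.
rewrite {1}Hgs; apply: generated_min => [|x0 /= xs]; last first.
  split; first by rewrite Hgs; apply: sub_generated.
  move=> e0; rewrite (geod_sep _ (hgeo x0)) => he0.
  exists 1, e0; rewrite gact1; split=> //; first exact: subgroup1.
  by apply/flattenP; exists (unzip1 (geo x0)) => //; apply: map_f.
split=> [|x0 y0 [Hx Px] [Hy Py]].
  by split=> [|e0]; [apply: subgroup1 | rewrite gact1 sep_refl].
split; first by apply: subgroupM => //; apply: subgroupV.
move=> e0; rewrite (sep_add _ _ (vact X x0 p)).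
case h0: (sep e0 p (vact X x0 p)); first by move=> _; apply: Px.
rewrite addFb => h1.
have : sep (eact X (y0 * x0^-1) e0) p (vact X y0 p).
  rewrite sep_sym -(sepJ (x0 * y0^-1)) -[eact X _ (eact X _ e0)]gactM -gactM.
  have -> : x0 * y0^-1 * y0 = x0 by rewrite mulgVK.
  by rewrite !mulgA mulgVK mulgV gact1.
move=> /Py[g [f [Hg fL ef]]]; exists (x0 * y0^-1 * g), f; split=> //.
  by do ![apply: subgroupM => //]; apply: subgroupV.
rewrite gactM -ef -gactM !mulgA mulgVK mulgV gact1 //.
Qed.

End Hull.

End TreeGeometry.

(** * Orbits and finite graphs *)

Section Orbits.
Local Open Scope classical_set_scope.
Local Open Scope group_scope.
Variables (G : groupType) (A : Type) (act : gaction G A) (H : set G).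
Hypothesis sH : subgroup H.
Implicit Types (a b z : A) (Z : set A).

Definition same_orbit a b : Prop := exists2 g, H g & b = act g a.

Lemma same_orbit_refl a : same_orbit a a.
Proof. by exists 1; [apply: subgroup1 | rewrite gact1]. Qed.

Lemma same_orbit_sym a b : same_orbit a b -> same_orbit b a.
Proof. by case=> g Hg ->; exists g^-1; [apply: subgroupV | rewrite gactK]. Qed.

Lemma same_orbit_trans a b c : same_orbit a b -> same_orbit b c -> same_orbit a c.
Proof.
by case=> g Hg -> [h Hh ->]; exists (h * g); [apply: subgroupM | rewrite gactM].
Qed.

Definition orbit_cover Z (L : seq A) : Prop :=
  forall z, Z z -> exists i : 'I_(size L), same_orbit (tnth (in_tuple L) i) z.

Lemma transversal_exists Z L : orbit_cover Z L ->
  exists (n : nat) (r : 'I_n -> A), [/\ (n <= size L)%N, forall i, Z (r i),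
    forall i j, same_orbit (r i) (r j) -> i = j &
    forall z, Z z -> exists i, same_orbit (r i) z].
Proof.
move=> hL.
suff [n [r [nL rZ rinj hr]]] : exists (n : nat) (r : 'I_n -> A),
    [/\ (n <= size L)%N, forall i, Z (r i),
    forall i j, same_orbit (r i) (r j) -> i = j &
    forall z, Z z -> (exists i : 'I_(size L), same_orbit (tnth (in_tuple L) i) z) ->
      exists i, same_orbit (r i) z].
  by exists n, r; split=> // z Zz; apply: hr => //; apply: hL.
elim: {hL} L => [|a L [n [r [nL rZ rinj hr]]]].
  exists 0%N, (fun i : 'I_0 => False_rect A (notF (ltn_ord i))).
  by split=> [//|[]//|[]//|z _ [[]]].
have [[z [Zz az nz]]|nex] := pselect (exists z, [/\ Z z, same_orbit a z &
    forall i, ~ same_orbit (r i) z]).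
  exists n.+1, (fun i => oapp r z (unlift ord0 i)); split=> //.
  - by move=> i; case: unliftP => [j|] /= _; [apply: rZ | ].
  - move=> i j; case: unliftP => [i' ->|->]; case: unliftP => [j' ->|->] //= h.
    + by rewrite (rinj _ _ h).
    + by case: (nz _ h).
    + by case: (nz j'); apply: same_orbit_sym.
  - move=> y Zy [i hi].
    case: (unliftP ord0 i) hi => [j ->|->] hi; last first.
      exists ord0; rewrite unlift_none /=.
      apply: same_orbit_trans hi; apply: same_orbit_sym.
      by rewrite (tnth_nth a).
    have [|k hk] := hr y Zy.
      by exists j; move: hi; rewrite !(tnth_nth a) /=.
    by exists (lift ord0 k); rewrite liftK.
exists n, r; split=> //; first exact: leqW.
move=> y Zy [i hi].
case: (unliftP ord0 i) hi => [j ->|->] hi; last first.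
  apply: contrapT => ny; apply: nex; exists y; split=> //.
  by move=> k hk; apply: ny; exists k.
by apply: hr => //; exists j; move: hi; rewrite !(tnth_nth a) /=.
Qed.

End Orbits.

Section ProductAction.
Local Open Scope group_scope.
Variables (G : groupType) (A B : Type).
Variables (actA : gaction G A) (actB : gaction G B).

Definition prod_act g (z : A * B) : A * B := (actA g z.1, actB g z.2).

Lemma prod_act1 z : prod_act 1 z = z.
Proof. by case: z => a b; rewrite /prod_act !gact1. Qed.

Lemma prod_actM g h z : prod_act (g * h) z = prod_act g (prod_act h z).
Proof. by rewrite /prod_act !gactM. Qed.

Definition prod_action := GAction prod_act1 prod_actM.

End ProductAction.

Section FiniteCounting.

(** The elements of [A] are the half-edges of a finite graph with vertices [B],
    and [sg] is the origin.  The sum of [degree - 2] over the vertices is twice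
    the excess [M] of the edges over the vertices; vertices of degree less than
    [2] are allowed in [Q] only, and at a vertex in [P], which has degree [d]
    at least [3], the contribution [d - 2] is at least [d / 3]. *)
Lemma branch_half_edges_bound (A B : finType) (sg : A -> B) (P Q : pred B)
    (M q : nat) :
  (#|A| <= 2 * (M + #|B|))%N -> (#|[pred j | Q j]| <= q)%N ->
  (forall j, P j -> 3 <= #|[pred i | sg i == j]|)%N ->
  (forall j, ~~ P j -> ~~ Q j -> 2 <= #|[pred i | sg i == j]|)%N ->
  (#|[pred i | P (sg i)]| <= 6 * (M + q))%N.
Proof.
move=> hA hQ h3 h2.
pose fib j := #|[pred i | sg i == j]|.
have cardP (R : pred B) : #|[pred i | R (sg i)]| = (\sum_(j | R j) fib j)%N.
  rewrite -sum1_card (partition_big sg R) //=; apply: eq_bigr => j Rj.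
  rewrite /fib -sum1_card; apply: eq_bigl => i.
  by rewrite !inE; apply/andP/eqP => [[_ /eqP]//|ij]; rewrite ij Rj eqxx.
have e1 : #|A| = (\sum_(j | P j) fib j + \sum_(j | ~~ P j) fib j)%N.
  rewrite -(bigID P xpredT) /= -(cardP xpredT); apply: eq_card => i.
  by rewrite !inE.
have e2 : #|B| = (#|[pred j | P j]| + #|[pred j | ~~ P j]|)%N.
  rewrite -(cardID [pred j | P j] B); congr (_ + _)%N; apply: eq_card => j;
  by rewrite !inE ?andbT.
have e3 : (3 * #|[pred j | P j]| <= \sum_(j | P j) fib j)%N.
  by rewrite mulnC -sum_nat_const; apply: leq_sum => j Pj; apply: h3.
have e4 : (2 * #|[pred j | ~~ P j]| <= \sum_(j | ~~ P j) fib j + 2 * q)%N.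
  have : (2 * #|[pred j | ~~ P j & ~~ Q j]| <= \sum_(j | ~~ P j && ~~ Q j) fib j)%N.
    by rewrite mulnC -sum_nat_const; apply: leq_sum => j /andP[Pj Qj]; apply: h2.
  have : (#|[pred j | ~~ P j]| <= #|[pred j | ~~ P j & ~~ Q j]| + q)%N.
    apply: leq_trans (leq_add (leqnn _) hQ).
    rewrite -cardUI; apply: leq_trans (leq_addr _ _); apply: subset_leq_card.
    by apply/fintype.subsetP => j; rewrite !inE; case: (Q j); rewrite ?andbT ?orbT ?orbF.
  have : (\sum_(j | ~~ P j && ~~ Q j) fib j <= \sum_(j | ~~ P j) fib j)%N.
    by rewrite [X in (_ <= X)%N](bigID Q) /= addnC leq_addr.
  lia.
rewrite cardP; lia.
Qed.

Lemma card_le_fibres (A B : finType) (f : A -> B) (P : pred B) m :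
  (forall a, P (f a)) -> (forall b, #|[pred a | f a == b]| <= m)%N ->
  (#|A| <= m * #|[pred b | P b]|)%N.
Proof.
move=> hP hm; rewrite -sum1_card (partition_big f P) //=.
rewrite mulnC -sum_nat_const; apply: leq_sum => b _.
rewrite sum1_card; apply: leq_trans (hm b).
by apply/subset_leq_card/fintype.subsetP => a; rewrite !inE.
Qed.

End FiniteCounting.

Section TreeSums.
Local Open Scope classical_set_scope.
Local Open Scope group_scope.
Variables (G : groupType) (X : gtree G).
Local Notation V := (tvert X).
Local Notation E := (tedge X).
Local Notation origin := (origin (@tend G X)).
Local Notation terminus := (terminus (@tend G X)).
Local Notation walk := (walk (@tend G X)).

Section OneFunction.
Variable D : E -> bool.

(** Modulo 2, an edge contributes to the sum along a walk only if it separates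
    the ends, whatever the walk. *)
Lemma walk_sum (U : seq E) x s y : walk x s y -> uniq U ->
  {subset unzip1 s <= U} ->
  \big[addb/false]_(h <- s) D h.1 = \big[addb/false]_(e <- U | sep e x y) D e.
Proof.
move=> + uU; elim: s x => [|h s IHs] x /=.
  by move=> -> _; rewrite big_nil big1 // => e; rewrite sep_refl.
move=> [<- ws] hU; rewrite big_cons (IHs _ ws); last first.
  by move=> e es; apply: hU; rewrite inE es orbT.
rewrite big_mkcond [RHS]big_mkcond /=.
have hin : h.1 \in U by apply: hU; rewrite inE eqxx.
have -> : D h.1 = \big[addb/false]_(e <- U) (if e == h.1 then D e else false).
  by rewrite (bigD1_seq h.1) //= eqxx big1_seq ?addbF // => e /andP[/negbTE->].
rewrite -big_split; apply: eq_bigr => e _.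
rewrite (sep_add _ (origin h) (terminus h)) sep_half.
by case: (e == h.1); case: (sep _ _ _); case: (D e).
Qed.

Definition tree_sum x y : bool :=
  \big[addb/false]_(h <- xget [::] [set s | geod x s y]) D h.1.

Lemma walk_tree_sum x s y : walk x s y ->
  \big[addb/false]_(h <- s) D h.1 = tree_sum x y.
Proof.
move=> ws; rewrite /tree_sum; set t := xget _ _.
have [wt _] : geod x t y by apply: (xgetPex _ (geod_exists x y)).
rewrite (walk_sum ws (undup_uniq (unzip1 s ++ unzip1 t))); last first.
  by move=> e es; rewrite mem_undup mem_cat es.
rewrite (walk_sum wt (undup_uniq (unzip1 s ++ unzip1 t))) //.
by move=> e es; rewrite mem_undup mem_cat es orbT.
Qed.

Lemma tree_sum_add x y z : tree_sum x z = tree_sum x y (+) tree_sum y z.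
Proof.
have [s [ws _]] := geod_exists x y; have [t [wt _]] := geod_exists y z.
rewrite -(walk_tree_sum ws) -(walk_tree_sum wt) -big_cat.
by rewrite -(@walk_tree_sum x (s ++ t)) //; apply/walk_cat; exists y.
Qed.

Lemma tree_sum_refl x : tree_sum x x = false.
Proof. by rewrite -(@walk_tree_sum x [::]) // big_nil. Qed.

Lemma tree_sum_sym x y : tree_sum x y = tree_sum y x.
Proof.
have := tree_sum_add x y x; rewrite tree_sum_refl.
by case: (tree_sum x y); case: (tree_sum y x).
Qed.

Lemma tree_sum_edge e : tree_sum (tend e false) (tend e true) = D e.
Proof. by rewrite -(@walk_tree_sum _ [:: (e, false)]) // big_seq1. Qed.

End OneFunction.

Lemma tree_sumJ (D D' : E -> bool) g x y :
  (forall e, D (eact X g e) = D' e) ->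
  tree_sum D (vact X g x) (vact X g y) = tree_sum D' x y.
Proof.
move=> DD; have [s [ws _]] := geod_exists x y.
rewrite -(walk_tree_sum _ ws) -(walk_tree_sum _ (walkJ g ws)) big_map.
by apply: eq_bigr => h _; rewrite -DD.
Qed.

Lemma tree_sum_addb (D D' : E -> bool) x y :
  tree_sum (fun e => D e (+) D' e) x y = tree_sum D x y (+) tree_sum D' x y.
Proof. by rewrite /tree_sum big_split. Qed.

End TreeSums.

(** * The branching of the subtree of a finitely generated group *)

Section BranchBound.
Local Open Scope classical_set_scope.
Local Open Scope group_scope.
Variables (G : groupType) (X : gtree G).
Local Notation V := (tvert X).
Local Notation E := (tedge X).
Local Notation origin := (origin (@tend G X)).
Local Notation terminus := (terminus (@tend G X)).
Variables (p : V) (H : set G).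
Hypothesis sH : subgroup H.

Section Euler.
Variables (gs : seq G) (B : finType) (actB : gaction G B).
Hypothesis Hgs : H = generated [set` gs].

(** The quotient of the subtree times [B] is a finite graph.  A function on its
    edges with values in the field with two elements that sums to zero along
    the paths from [p] to its images by the generators is a coboundary, so it
    vanishes if its primitive does: this bounds the number of edges. *)
Lemma euler_bound NE (clE : E -> B -> option 'I_NE) NV (rV : 'I_NV -> V * B) :
  (forall g e b, H g -> clE (eact X g e) (actB g b) = clE e b) ->
  (forall i, exists e b, hull_edge p H e /\ clE e b = Some i) ->
  (forall v b, in_hull p H v ->
     exists i, same_orbit (prod_action (vact X) actB) H (rV i) (v, b)) ->
  (NE <= size gs * #|B| + NV)%N.
Proof.
move=> clJ cl_surj hV.
pose vl (c : {ffun 'I_NE -> bool}) b e := if clE e b is Some i then c i else false.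
(* The sums from [p] to its images by the generators and to the vertex
   representatives; [D] below is the difference of two functions with the same
   sums. *)
pose Phi c := ([ffun z : 'I_(size gs) * B =>
                  tree_sum (vl c z.2) p (vact X gs`_z.1 p)],
               [ffun i => tree_sum (vl c (rV i).2) p (rV i).1]).
suff /leq_card : injective Phi.
  rewrite card_ffun card_prod !card_ffun !card_bool card_prod !card_ord.
  by rewrite -expnD leq_exp2l.
move=> c c' [/ffunP h1 /ffunP h2].
pose D b e := vl c b e (+) vl c' b e.
have DJ g b e : H g -> D (actB g b) (eact X g e) = D b e.
  by move=> Hg; rewrite /D /vl clJ.
have Dgs a b : a \in gs -> tree_sum (D b) p (vact X a p) = false.
  move=> ags; have ai : (index a gs < size gs)%N by rewrite index_mem.
  have := h1 (Ordinal ai, b); rewrite !ffunE /= nth_index // => e1.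
  by rewrite tree_sum_addb e1 addbb.
have D2 i : tree_sum (D (rV i).2) p (rV i).1 = false.
  by have := h2 i; rewrite !ffunE tree_sum_addb => ->; rewrite addbb.
have DH a b : H a -> tree_sum (D b) p (vact X a p) = false.
  suff PH : H `<=` [set x | H x /\ forall b, tree_sum (D b) p (vact X x p) = false].
    by move=> /PH[].
  rewrite {1}Hgs; apply: generated_min => [|x /= xs]; last first.
    by split=> [|b']; [rewrite Hgs; apply: sub_generated | apply: Dgs].
  split=> [|x y [Hx Px] [Hy Py]].
    by split=> [|b']; [apply: subgroup1 | rewrite gact1 tree_sum_refl].
  split=> [|b']; first by apply: subgroupM => //; apply: subgroupV.
  rewrite (tree_sum_add _ _ (vact X x p)) Px addFb.
  have Hyx : H (y * x^-1) by apply: subgroupM => //; apply: subgroupV.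
  rewrite -(@tree_sumJ _ _ (D (actB (y * x^-1) b')) (D b') (y * x^-1)); last first.
    by move=> e; apply: DJ.
  rewrite -!gactM tree_sum_sym.
  have -> : y * x^-1 * (x * y^-1) = 1 by rewrite mulgA mulgVK mulgV.
  by rewrite mulgVK gact1.
have Dhull v b : in_hull p H v -> tree_sum (D b) p v = false.
  move=> hv; have [i [g Hg [-> ->]]] := hV v b hv.
  rewrite (tree_sum_add _ _ (vact X g p)) DH // addFb.
  rewrite (@tree_sumJ _ _ _ (D (rV i).2)) //.
  by move=> e; apply: DJ.
apply/ffunP => i; have [e [b [he ei]]] := cl_surj i.
have hend b' : in_hull p H (tend e b').
  by right; exists (e, b').
have := tree_sum_edge (D b) e.
rewrite (tree_sum_add _ _ p) tree_sum_sym !Dhull // /D /vl ei.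
by case: (c i); case: (c' i).
Qed.

End Euler.

(** A set of half-edges of the subtree at [v], not necessarily all of them: the
    degree may be infinite, and only three are ever needed. *)
Definition star (v : V) (s : seq (E * bool)) : Prop :=
  uniq (unzip1 s) /\ forall h, h \in s -> origin h = v /\ hull_edge p H h.1.

Definition branch (v : V) : Prop := exists2 s, star v s & size s = 3.

Definition branch_half (h : E * bool) : Prop :=
  hull_edge p H h.1 /\ branch (origin h).

Lemma starJ g v s : H g -> star v s ->
  star (vact X g v) [seq half_action X g h | h <- s].
Proof.
move=> Hg [us hs]; split.
  rewrite /unzip1 -map_comp (eq_map (_ : _ =1 eact X g \o fst)) // map_comp.
  by rewrite map_inj_uniq //; apply: can_inj (gactK (eact X) g).
move=> _ /mapP[h /hs[hv hh] ->]; rewrite orgJ hv; split=> //.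
exact: hull_edgeJ.
Qed.

Lemma branchJ g v : H g -> branch v -> branch (vact X g v).
Proof.
by move=> Hg [s hs s3]; eexists; [apply: starJ hs | rewrite size_map].
Qed.

Lemma in_hull_star v : exists s, [/\ star v s, branch v -> size s = 3 &
  in_hull p H v -> ~ in_orbit p H v -> (2 <= size s)%N].
Proof.
have [[s hs s3]|nb] := pselect (branch v); first by exists s; rewrite s3.
have [[[//|[h hv hh]] nv]|nv] := pselect (in_hull p H v /\ ~ in_orbit p H v).
  rewrite -hv in nv; have [k [kv kh hk]] := hull_second hh nv.
  exists [:: h; k]; split=> //; split=> [|l].
    by rewrite /= inE eq_sym kh.
  by rewrite !inE => /orP[] /eqP ->; rewrite ?kv.
by exists [::]; split=> // h1 h2; case: nv.
Qed.

Variable m : nat.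
Hypothesis stabE : forall e : E, exists2 s : seq G,
  (size s <= m)%N & forall g, eact X g e = e -> g \in s.

Lemma half_transporter (h k : E * bool) :
  exists2 s : seq G, (size s <= m)%N &
    forall g, half_action X g h = k -> g \in s.
Proof.
have [[g0 hg0]|nex] := pselect (exists g, half_action X g h = k); last first.
  by exists [::] => // g hg; case: nex; exists g.
have [s sm hs] := stabE h.1; exists [seq g0 * x | x <- s]; first by rewrite size_map.
move=> g hg; apply/mapP; exists (g0^-1 * g); last by rewrite mulVKg.
apply: hs; rewrite gactM.
have -> : eact X g h.1 = (half_action X g h).1 by [].
by rewrite hg -hg0 /= gactK.
Qed.

Hypothesis RF : forall F : seq G,
  (forall x, x \in F -> x <> 1 /\ exists v, vact X x v = v) ->
  exists (B : finType) (act : gaction G B) (b0 : B),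
    forall x, x \in F -> forall b, act x b <> b.

(** Three half-edges, or two, are chosen at each of finitely many representatives
    of the vertices.  The elements of the group that fix a representative and
    move one chosen half-edge to another are finitely many, and [B] is a set on
    which they have no fixed point: so the chosen half-edges remain distinct in
    the quotient of the subtree times [B]. *)
Lemma branch_bound (gs : seq G) : H = generated [set` gs] ->
  exists (n : nat) (r : 'I_n -> E * bool), (n <= 6 * m * (size gs + 1))%N /\
    forall h, branch_half h -> exists i, same_orbit (half_action X) H (r i) h.
Proof.
move=> Hgs.
have [LE hLE] := hull_edge_cofinite p sH Hgs.
pose Lv := p :: [seq tend e b | e <- LE, b <- [:: false; true]].
have hLv v : in_hull p H v -> exists g v0, [/\ H g, v0 \in Lv & v = vact X g v0].
  case=> [[a Ha ->]|[[e b] <- /hLE[g [f [Hg fL /= ->]]]]].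
    by exists a, p; rewrite inE eqxx.
  exists g, (tend f b); split=> //; last exact: tendJ.
  rewrite inE; apply/orP; right; apply/allpairsP; exists (f, b); split=> //=.
  by case: (b); rewrite !inE.
have /boolp.choice[D hD] := in_hull_star.
have /boolp.choice[trans htrans] : forall hk, exists s : seq G,
    forall g, half_action X g hk.1 = hk.2 -> g \in s.
  by move=> [h k]; have [s _ hs] := half_transporter h k; exists s.
pose F := [seq g <- flatten [seq flatten [seq flatten [seq trans (h, k)
   | k <- D v] | h <- D v] | v <- Lv] | `[< g <> 1 /\ exists v, vact X g v = v >]].
have FP g v h k : v \in Lv -> h \in D v -> k \in D v -> h <> k ->
    half_action X g h = k -> g \in F.
  move=> vL hv kv hk gh; rewrite mem_filter; apply/andP; split.
    apply/asboolP; split; first by move=> g1; apply: hk; rewrite -gh g1 gact1.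
    have [[_ Dv] _ _] := hD v.
    by exists v; rewrite -{1}(Dv h hv).1 -orgJ gh (Dv k kv).1.
  apply/flattenP; eexists; first by apply: map_f vL.
  apply/flattenP; eexists; first by apply: map_f hv.
  apply/flattenP; eexists; first by apply: map_f kv.
  exact: htrans.
have [|B [actB [b0 hB]]] := RF (F := F).
  by move=> x; rewrite mem_filter => /andP[/asboolP].
pose aE := prod_action (eact X) actB.
pose aV := prod_action (vact X) actB.
have cvE : orbit_cover aE H [set z | hull_edge p H z.1]
    [seq (f, b) | f <- LE, b <- enum B].
  move=> [e b] /= /hLE[g [f [Hg fL ->]]].
  have hin : (f, actB g^-1 b) \in [seq (f, b) | f <- LE, b <- enum B].
    by apply: allpairs_f; rewrite ?mem_enum.
  have hi := hin; rewrite -index_mem in hi; exists (Ordinal hi), g => //.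
  by rewrite (tnth_nth (f, b)) /= nth_index // /aE /= /prod_act /= gactKV.
have [NE [rE [_ rEZ rE_inj rE_surj]]] := transversal_exists sH cvE.
have cvV : orbit_cover aV H [set z | in_hull p H z.1]
    [seq (v, b) | v <- Lv, b <- enum B].
  move=> [v b] /= /hLv[g [f [Hg fL ->]]].
  have hin : (f, actB g^-1 b) \in [seq (v, b) | v <- Lv, b <- enum B].
    by apply: allpairs_f; rewrite ?mem_enum.
  have hi := hin; rewrite -index_mem in hi; exists (Ordinal hi), g => //.
  by rewrite (tnth_nth (f, b)) /= nth_index // /aV /= /prod_act /= gactKV.
have [NV [rV [_ rVZ rV_inj rV_surj]]] := transversal_exists sH cvV.
pose clE e b := [pick i | `[< same_orbit aE H (rE i) (e, b) >]].
have clEP e b i : clE e b = Some i <-> same_orbit aE H (rE i) (e, b).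
  rewrite /clE; case: pickP => [j /asboolP hj|hn].
    split=> [[<-] //|hi]; congr Some; apply: rE_inj.
    exact: (same_orbit_trans sH hj (same_orbit_sym sH hi)).
  by split=> // /asboolP; rewrite hn.
have clEJ g e b : H g -> clE (eact X g e) (actB g b) = clE e b.
  move=> Hg; apply: eq_pick => i; apply: asbool_equiv_eq.
  have hg : same_orbit aE H (e, b) (eact X g e, actB g b) by exists g.
  split=> h; first exact: (same_orbit_trans sH h (same_orbit_sym sH hg)).
  exact: (same_orbit_trans sH h hg).
have clE_hull e b : hull_edge p H e -> exists i, clE e b = Some i.
  move=> he; have [i hi] := rE_surj (e, b) he.
  by exists i; apply/clEP.
have NE_le : (NE <= size gs * #|B| + NV)%N.
  apply: (euler_bound Hgs clEJ (rV := rV)).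
    move=> i; exists (rE i).1, (rE i).2; split; first exact: rEZ.
    by apply/clEP; rewrite -surjective_pairing; apply: same_orbit_refl.
  by move=> v b hv; apply: rV_surj.
have /boolp.choice[sg hsg] : forall a : 'I_NE * bool, exists j,
    same_orbit aV H (rV j) (tend (rE a.1).1 a.2, (rE a.1).2).
  move=> [i b]; apply: rV_surj; right; exists ((rE i).1, b) => //.
  exact: rEZ.
have sgE i h b : clE h.1 b = Some i ->
    same_orbit aV H (rV (sg (i, h.2))) (origin h, b).
  move=> /clEP[g Hg [e1 e2]].
  apply: (same_orbit_trans sH (hsg (i, h.2))); exists g => //.
  by rewrite /aV /= /prod_act /= -tendJ -e1 -e2.
(* In the quotient graph a vertex keeps the half-edges chosen by [D] distinct,
   by the choice of [B]. *)
pose P j := `[< branch (rV j).1 >].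
pose Q j := `[< in_orbit p H (rV j).1 >].
have fibre j s : star (rV j).1 s ->
    (forall h k g, h \in s -> k \in s -> H g -> actB g (rV j).2 = (rV j).2 ->
       half_action X g h = k -> h = k) ->
    (size s <= #|[pred a | sg a == j]|)%N.
  case: s => [//|h0 s0]; set s := h0 :: s0.
  move=> [us hs] hinj; set b := (rV j).2 in hinj *.
  have h0s : h0 \in s by rewrite inE eqxx.
  have [i0 _] := clE_hull _ b (hs h0 h0s).2.
  have /boolp.choice[cl hcl] : forall h, exists i : 'I_NE,
      h \in s -> clE h.1 b = Some i.
    move=> h; have [hin|hn] := boolP (h \in s); last by exists i0.
    by have [i hi] := clE_hull _ b (hs h hin).2; exists i.
  pose f h := (cl h, h.2).
  have f_inj : {in s &, injective f}.
    move=> h k hin kin [chk hk2].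
    have /clEP h1 := hcl h hin; have /clEP h2 := hcl k kin.
    rewrite chk in h1.
    have [g Hg [e1 e2]] := same_orbit_trans sH (same_orbit_sym sH h1) h2.
    apply: (hinj h k g) => //.
    by rewrite /= /hact -e1 hk2; case: (k).
  rewrite -(size_map f) -(card_uniqP _); last first.
    by rewrite map_inj_in_uniq //; apply: map_uniq us.
  apply: subset_leq_card; apply/fintype.subsetP => _ /mapP[h hin ->].
  rewrite inE; apply/eqP/rV_inj.
  apply: (same_orbit_trans sH (sgE _ h b (hcl h hin))).
  by rewrite (hs h hin).1 -surjective_pairing; apply: same_orbit_refl.
have fibreD j : exists2 s, star (rV j).1 s &
    [/\ (size s <= #|[pred a | sg a == j]|)%N, P j -> size s = 3 &
    ~~ Q j -> (2 <= size s)%N].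
  have hj := rVZ j; have [g [v0 [Hg v0L jv]]] := hLv _ hj.
  have [st0 b3 b2] := hD v0.
  have st : star (rV j).1 [seq half_action X g h | h <- D v0].
    by rewrite jv; apply: starJ.
  exists [seq half_action X g h | h <- D v0] => //; rewrite size_map; split.
  - rewrite -(size_map (half_action X g)); apply: fibre => //.
    move=> _ _ x /mapP[h hin ->] /mapP[k kin ->] Hx xb xhk.
    have [-> //|/eqP hk] := eqVneq h k.
    have /hB : g^-1 * x * g \in F.
      apply: (FP _ v0 h k) => //; rewrite !gactM xhk gactK //.
    case/(_ (actB g^-1 (rV j).2)).
    by rewrite -gactM mulgK gactM xb.
  - move=> /asboolP hb; apply: b3.
    have : branch (vact X g^-1 (rV j).1) by apply: branchJ => //; apply: subgroupV.
    by rewrite jv gactK.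
  - move=> /asboolP nq; apply: b2.
      have : in_hull p H (vact X g^-1 (rV j).1).
        by apply: in_hullJ => //; apply: subgroupV.
      by rewrite jv gactK.
    by move=> hq; apply: nq; rewrite jv; apply: in_orbitJ.
(* The vertices of [Q], which may have a smaller degree, are classes of pairs
   [(p, b)]. *)
have Qle : (#|[pred j | Q j]| <= #|B|)%N.
  have /boolp.choice[a ha] : forall j, exists a, Q j -> H a /\ (rV j).1 = vact X a p.
    move=> j; have [[a Ha ja]|nq] := pselect (in_orbit p H (rV j).1); first by exists a.
    by exists 1 => /asboolP.
  pose f j := actB (a j)^-1 (rV j).2.
  apply: (@leq_card_in _ _ f) => // i j qi qj fij.
  have orb k : Q k -> same_orbit aV H (p, f k) (rV k).
    move=> /ha[Hk kp]; exists (a k) => //.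
    by rewrite /aV /= /prod_act /= -kp gactKV -surjective_pairing.
  have hi : same_orbit aV H (rV i) (p, f j).
    rewrite -fij; exact: (same_orbit_sym sH (orb i qi)).
  exact: rV_inj (same_orbit_trans sH hi (orb j qj)).
have hbound : (#|[pred a | P (sg a)]| <= 6 * (size gs * #|B| + #|B|))%N.
  apply: (branch_half_edges_bound (Q := Q)) => //.
  - by rewrite card_prod !card_ord card_bool; lia.
  - move=> j pj; have [s _ [hs hP _]] := fibreD j.
    by rewrite -(hP pj).
  - move=> j _ qj; have [s _ [hs _ hQ]] := fibreD j.
    exact: leq_trans (hQ qj) hs.
have cvB : orbit_cover (half_action X) H branch_half
    [seq (f, b) | f <- LE, b <- [:: false; true]].
  move=> [e b] /= [/hLE[g [f [Hg fL /= ->]]] _].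
  have hin : (f, b) \in [seq (f, b) | f <- LE, b <- [:: false; true]].
    by apply: allpairs_f => //; case: (b); rewrite !inE.
  have hi := hin; rewrite -index_mem in hi; exists (Ordinal hi), g => //.
  by rewrite (tnth_nth (f, b)) /= nth_index.
have [n [r [_ rZ r_inj r_surj]]] := transversal_exists sH cvB.
exists n, r; split=> //.
have /boolp.choice[ff hff] : forall z : 'I_n * B, exists a : 'I_NE * bool,
    clE (r z.1).1 z.2 = Some a.1 /\ a.2 = (r z.1).2.
  move=> [i b]; have [j hj] := clE_hull _ b (rZ i).1.
  by exists (j, (r i).2).
have ffP z : P (sg (ff z)).
  have [h1 h2] := hff z; have [g Hg [e1 _]] := sgE _ _ _ h1.
  rewrite -h2 -surjective_pairing in e1; apply/asboolP.
  have : branch (vact X g^-1 (origin (r z.1))).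
    by apply: branchJ; [apply: subgroupV | case: (rZ z.1)].
  by rewrite e1 gactK.
(* An orbit of half-edges of the tree has at least [#|B| / m] classes above it in
   the quotient graph. *)
have ff_fib a : (#|[pred z | ff z == a]| <= m)%N.
  have [z0 /eqP hz0|hn] := pickP [pred z | ff z == a]; last by rewrite eq_card0.
  have [s sm hs] := stabE (r z0.1).1.
  apply: leq_trans sm; rewrite -(size_map (fun g => (z0.1, actB g z0.2))).
  apply: leq_trans (card_size _); apply: subset_leq_card.
  apply/fintype.subsetP => z; rewrite inE => /eqP hz.
  have [/clEP c1 d1] := hff z; have [/clEP c0 d0] := hff z0.
  rewrite hz -hz0 in c1 d1.
  have [g Hg [e1 e2]] := same_orbit_trans sH (same_orbit_sym sH c0) c1.
  have z01 : z0.1 = z.1.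
    apply: r_inj; exists g => //=; rewrite /hact -e1 -d0 d1.
    exact: surjective_pairing.
  apply/mapP; exists g; first by apply: hs; rewrite -e1 z01.
  by rewrite z01 -e2 -surjective_pairing.
have B0 : (0 < #|B|)%N by apply/card_gt0P; exists b0.
have := card_le_fibres (P := fun a => P (sg a)) ffP ff_fib.
rewrite card_prod card_ord => hn; rewrite -(leq_pmul2r B0).
apply: leq_trans hn _; apply: leq_trans (leq_mul (leqnn m) hbound) _.
lia.
Qed.

End BranchBound.

(** * Generators of the intersection *)

Section IntersectionOrbits.
Local Open Scope classical_set_scope.
Local Open Scope group_scope.
Variables (G : groupType) (A : eqType) (act : gaction G A) (m : nat).
Hypothesis transporter : forall a b, exists2 s : seq G,
  (size s <= m)%N & forall g, act g a = b -> g \in s.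

(** The points [act x1 a1 = act x2 a2] with [xi] in [Ki] form one orbit of the
    intersection for each value of [x1^-1 * x2], which moves [a2] to [a1]. *)
Lemma orbits_setI (K1 K2 : set G) (I1 I2 : finType)
    (r1 : I1 -> A) (r2 : I2 -> A) (W : set A) :
  subgroup K1 -> subgroup K2 ->
  (forall z, W z -> exists i, same_orbit act K1 (r1 i) z) ->
  (forall z, W z -> exists i, same_orbit act K2 (r2 i) z) ->
  exists r : I1 * I2 * 'I_m -> A,
    forall z, W z -> exists i, same_orbit act (K1 `&` K2) (r i) z.
Proof.
move=> s1 s2 h1 h2.
have /boolp.choice[tr htr] : forall ij : I1 * I2, exists s : seq G,
    (size s <= m)%N /\ forall g, act g (r2 ij.2) = r1 ij.1 -> g \in s.
  by move=> ij; have [s] := transporter (r2 ij.2) (r1 ij.1); exists s.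
pose good (k : I1 * I2 * 'I_m) x := exists x1 x2, [/\ K1 x1, K2 x2,
  x = act x1 (r1 k.1.1), x = act x2 (r2 k.1.2) & x1^-1 * x2 = (tr k.1)`_k.2].
have /boolp.choice[r hr] : forall k, exists x, (exists y, good k y) -> good k x.
  move=> k; have [[y gy]|ny] := pselect (exists y, good k y); first by exists y.
  by exists (r1 k.1.1).
exists r => z Wz.
have [i [x1 K1x z1]] := h1 z Wz; have [j [x2 K2x z2]] := h2 z Wz.
have [sm hs] := htr (i, j).
have hin : x1^-1 * x2 \in tr (i, j).
  by apply: hs; rewrite gactM -z2 z1 gactK.
have hk : (index (x1^-1 * x2)%g (tr (i, j)) < m)%N.
  by apply: leq_trans sm; rewrite index_mem.
pose k := (i, j, Ordinal hk); exists k.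
have [|y1 [y2 [K1y K2y e1 e2 e3]]] := hr k.
  by exists z, x1, x2; split=> //=; rewrite nth_index.
rewrite /= nth_index // in e3.
have e4 : x1 * y1^-1 = x2 * y2^-1.
  apply: (mulgI x1^-1); rewrite mulKg mulgA -e3 -mulgA mulgV mulg1 //.
exists (x1 * y1^-1); last by rewrite gactM {1}e1 gactK.
split; first by apply: subgroupM => //; apply: subgroupV.
by rewrite e4; apply: subgroupM => //; apply: subgroupV.
Qed.

End IntersectionOrbits.

Section Generation.
Local Open Scope classical_set_scope.
Local Open Scope group_scope.
Variables (G : groupType) (X : gtree G).
Local Notation V := (tvert X).
Local Notation E := (tedge X).
Local Notation origin := (origin (@tend G X)).
Local Notation terminus := (terminus (@tend G X)).

Definition dist (x y : V) : nat := size (xget [::] [set s | geod x s y]).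

Lemma geod_dist x s y : geod x s y -> dist x y = size s.
Proof.
move=> gs; rewrite /dist; congr size.
apply: geod_inj (gs); exact: (xgetPex _ (geod_exists x y)).
Qed.

Lemma distJ g x y : dist (vact X g x) (vact X g y) = dist x y.
Proof.
have [s gs] := geod_exists x y.
by rewrite (geod_dist gs) (geod_dist (geodJ g gs)) size_map.
Qed.

Lemma common_prefix (T : eqType) (s t : seq T) : exists c a b,
  [/\ s = c ++ a, t = c ++ b &
      [\/ a = [::], b = [::] | exists x y a' b',
         [/\ a = x :: a', b = y :: b' & x != y]]].
Proof.
elim: s t => [|x s IHs] t; first by exists [::], [::], t; split=> //; constructor 1.
case: t => [|y t]; first by exists [::], (x :: s), [::]; split=> //; constructor 2.
have [->|xy] := eqVneq x y.
  have [c [a [b [-> -> h]]]] := IHs t.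
  by exists (y :: c), a, b; split.
exists [::], (x :: s), (y :: t); split=> //; constructor 3.
by exists x, y, s, t.
Qed.

Variables (p : V) (K : set G).
Hypothesis sK : subgroup K.

(** The ends of the arcs into which the subtree is cut. *)
Definition special (v : V) : Prop := in_orbit p K v \/ branch p K v.

Lemma special_hull v : special v -> in_hull p K v.
Proof.
case=> [|[[//|h s] [_ hs] _]]; first by left.
by right; exists h; apply hs; rewrite inE eqxx.
Qed.

Lemma specialJ g v : K g -> special v -> special (vact X g v).
Proof. by move=> Kg [] h; [left; apply: in_orbitJ | right; apply: branchJ]. Qed.

Lemma special_base : special p.
Proof. by left; exists 1; [apply: subgroup1 | rewrite gact1]. Qed.

(** Where the geodesics from [u] to [z] and to [w] diverge there is a special
    vertex; it cannot be closer to [u] than [z], so it is [z] itself. *)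
Lemma special_closest u z w h t : special u -> special z -> special w ->
  geod u (h :: t) w -> sep h.1 u z ->
  (forall w', special w' -> sep h.1 u w' -> (dist u z <= dist u w')%N) ->
  (dist z w < dist u w)%N.
Proof.
move=> Wu Wz Ww gw uz zmin.
have [[|k s] gz] := geod_exists u z; first by case: gz uz => /= -> _; rewrite sep_refl.
have hk : h = k by apply: geod_head gz _ uz; case: gw => -[].
subst k.
have [c [a [b [es et hab]]]] := common_prefix (h :: s) (h :: t).
case: c es et => [|h' c] es et.
  by case: hab es et => [->|->|[x [y [a' [b' [-> -> xy]]]]]] // [ex _] [ey _];
     move: xy; rewrite -ex -ey eqxx.
case: es => hh' es; subst h'; case: et => et.
rewrite es -cat_cons in gz; rewrite et -cat_cons in gw.
have [mz [gm gma _]] := geod_cat gz; have [mw [gm' gmb _]] := geod_cat gw.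
have mm : mw = mz.
  apply: sep_eq => e; rewrite (sep_add _ _ u) sep_sym (geod_sep _ gm) (geod_sep _ gm').
  by rewrite addbb.
subst mw.
have sepm : sep h.1 u mz by rewrite (geod_sep _ gm) inE eqxx.
case: hab => [a0|b0|[x [y [a' [b' [ea eb xy]]]]]].
- have -> : z = mz by move: gma; rewrite a0 => -[].
  by rewrite (geod_dist gmb) (geod_dist gw) size_cat /=; lia.
- have wm : mz = w by move: gmb; rewrite b0 => -[].
  have := zmin w Ww; rewrite -wm => /(_ sepm).
  rewrite (geod_dist gz) (geod_dist gm) size_cat leqNgt => /negP h0.
  case: a es gz gma h0 => [|x a] es gz gma h0; last by case: h0 => /=; lia.
  have zm : mz = z by case: gma.
  rewrite -{1}zm wm (@geod_dist _ [::]) // (geod_dist gw) size_cat /=; lia.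
- suff Wm : special mz.
    have := zmin _ Wm sepm; rewrite (geod_dist gz) (geod_dist gm) size_cat ea /=.
    by lia.
  have [hu hz hw] : [/\ in_hull p K u, in_hull p K z & in_hull p K w].
    by split; apply: special_hull.
  have sz e : e \in unzip1 ((h :: c) ++ a) -> hull_edge p K e.
    by rewrite -(geod_sep _ gz); apply: in_hull_sep hu hz.
  have sw e : e \in unzip1 ((h :: c) ++ b) -> hull_edge p K e.
    by rewrite -(geod_sep _ gw); apply: in_hull_sep hu hw.
  have ox : origin x = mz by move: gma; rewrite ea => -[[]].
  have oy : origin y = mz by move: gmb; rewrite eb => -[[]].
  have := gm; have := sz; have := sw; have := gz; have := gw.
  case/lastP: {+}(h :: c) (isT : (0 < size (h :: c))%N) => // c0 l _.
  move=> [_ uw] [_ uz'] sw' sz' [wl _].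
  have ol : terminus l = mz.
    by move: wl; rewrite -cats1 => /walk_cat[v _ [_ <-]].
  right; exists [:: (l.1, ~~ l.2); x; y] => //; split.
    move: uw uz'; rewrite ea eb /unzip1 !map_cat !map_rcons !cat_uniq /=.
    rewrite !mem_rcons !inE !negb_or => /and3P[_ /andP[/andP[yl _] _] _].
    move=> /and3P[_ /andP[/andP[xl _] _] _].
    rewrite andbT eq_sym xl eq_sym yl /=.
    by apply: contra_neq xy => xy1; apply: half_edge_eq; rewrite ?ox ?oy.
  move=> k; rewrite !inE => /or3P[] /eqP -> /=; split=> //.
  - by apply: sz'; rewrite /unzip1 map_cat map_rcons mem_cat mem_rcons inE eqxx.
  - by apply: sz'; rewrite ea /unzip1 map_cat mem_cat /= inE eqxx orbT.
  - by apply: sw'; rewrite eb /unzip1 map_cat mem_cat /= inE eqxx orbT.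
Qed.

Definition special_half (h : E * bool) : Prop :=
  hull_edge p K h.1 /\ special (origin h).

Lemma special_halfJ g h : K g -> special_half h -> special_half (half_action X g h).
Proof.
move=> Kg [hh hs]; split; first exact: hull_edgeJ.
by rewrite orgJ; apply: specialJ.
Qed.

Lemma not_branch_halves v : ~ branch p K v ->
  exists (n : nat) (r : 'I_n -> E * bool), (n <= 2)%N /\
    forall h, origin h = v -> hull_edge p K h.1 -> exists i, r i = h.
Proof.
move=> nb.
have [[h1 [o1 e1]]|n1] := pselect (exists h, origin h = v /\ hull_edge p K h.1);
  last first.
  exists 0%N, (fun i : 'I_0 => False_rect _ (notF (ltn_ord i))).
  by split=> // h oh eh; case: n1; exists h.
have [[h2 [o2 e2 h12]]|n2] := pselect (exists h, [/\ origin h = v,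
    hull_edge p K h.1 & h1 <> h]); last first.
  exists 1%N, (fun=> h1); split=> // h oh eh; exists ord0; apply: contrapT => hh.
  by apply: n2; exists h.
exists 2, (fun i => if i == ord0 then h1 else h2); split=> // h oh eh.
have [<-|n1] := pselect (h1 = h); first by exists ord0.
have [<-|n2] := pselect (h2 = h); first by exists ord_max.
case: nb; exists [:: h1; h2; h] => //; split.
  have inj k l : origin k = v -> origin l = v -> k <> l -> k.1 != l.1.
    move=> ok ol kl; apply/eqP => e; apply: kl.
    by apply: half_edge_eq; rewrite ?ok ?ol.
  by rewrite /= !inE negb_or !inj.
by move=> k; rewrite !inE => /or3P[] /eqP ->.
Qed.

(** Half-edges at special vertices are branch half-edges, except for at most two
    at [p] and their translates. *)
Lemma special_half_cover (I : finType) (r : I -> E * bool) :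
  (forall h, branch_half p K h -> exists i, same_orbit (half_action X) K (r i) h) ->
  exists (J : finType) (l : J -> E * bool), (#|J| <= #|I| + 2)%N /\
    forall h, special_half h -> exists j, same_orbit (half_action X) K (l j) h.
Proof.
move=> hr.
have [bp|nbp] := pselect (branch p K p).
  exists I, r; split; first exact: leq_addr.
  move=> h [hh [[a Ka ha]|hb]]; apply: hr; split=> //.
  by rewrite ha; apply: branchJ.
have [n [r' [n2 hr']]] := not_branch_halves nbp.
exists (I + 'I_n)%type, (fun j => match j with inl i => r i | inr i => r' i end).
split; first by rewrite card_sum card_ord leq_add2l.
move=> h [hh [[a Ka ha]|hb]]; last first.
  by have [|i hi] := hr h; [split | exists (inl i)].
have [||i hi] := hr' (half_action X a^-1 h).
- by rewrite orgJ ha gactK.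
- by apply: hull_edgeJ => //; apply: subgroupV.
- by exists (inr i), a => //; rewrite hi gactKV.
Qed.

Variable rr : nat.
Hypothesis stabV : forall (v : V) (L : set G), subgroup L ->
  (forall g, L g -> vact X g v = v) -> gen_by L rr.

(** The group is generated by the stabilisers of representatives of the special
    vertices, by elements that identify representatives of the same orbit, and
    by elements that bring back to a representative the special vertex at the
    other end of each arc that leaves one. *)
Lemma gen_by_special (J : finType) (l : J -> E * bool) :
  (forall h, special_half h -> exists j, same_orbit (half_action X) K (l j) h) ->
  gen_by K (#|J|.+1 * rr + (#|J|.+1 + #|J|)).
Proof.
move=> hl.
pose L (o : option J) := if o is Some j then origin (l j) else p.
pose beyond j z := [/\ special z, sep (l j).1 (origin (l j)) z &
  forall w, special w -> sep (l j).1 (origin (l j)) w ->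
    (dist (origin (l j)) z <= dist (origin (l j)) w)%N].
have spL z : special z -> exists oy : option J * G, K oy.2 /\ z = vact X oy.2 (L oy.1).
  case=> [[a Ka ->]|bz]; first by exists (None, a).
  have [[//|h s] [_ hs] _] := bz.
  have [oh eh] : origin h = z /\ hull_edge p K h.1 by apply: hs; rewrite inE eqxx.
  have [|j [g Kg hj]] := hl h; first by split=> //; rewrite oh; right.
  by exists (Some j, g); split=> //=; rewrite -oh hj orgJ.
have beyondE j : special_half (l j) -> exists z, beyond j z.
  move=> [hj sj].
  have [q [q' [_ oq' _ hq']]] := hull_half hj.
  pose R n := `[< exists z, [/\ special z, sep (l j).1 (origin (l j)) z &
                               dist (origin (l j)) z = n] >].
  have hR : exists n, R n.
    by exists (dist (origin (l j)) q'); apply/asboolP; exists q'; split=> //; left.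
  case: (ex_minnP hR) => n /asboolP[z [sz hz zn]] nmin.
  exists z; split=> // w sw hw; rewrite zn; apply: nmin; apply/asboolP.
  by exists w.
have /boolp.choice[nx hnx] : forall j, exists oy : option J * G,
    K oy.2 /\ (special_half (l j) -> beyond j (vact X oy.2 (L oy.1))).
  move=> j; have [sj|nj] := pselect (special_half (l j)); last first.
    by exists (None, 1); split=> //; apply: subgroup1.
  have [z hz] := beyondE j sj; have [oy [Ky zE]] := spL z (let: And3 a _ _ := hz in a).
  by exists oy; rewrite -zE.
pose rho o := odflt o [pick o' | `[< same_orbit (vact X) K (L o) (L o') >]].
have rhoP o : same_orbit (vact X) K (L (rho o)) (L o).
  rewrite /rho; case: pickP => [o' /asboolP h|_]; last exact: same_orbit_refl.
  exact: same_orbit_sym.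
have rhoE o o' : same_orbit (vact X) K (L o) (L o') -> rho o = rho o'.
  move=> oo'; rewrite /rho.
  have -> : [pick i | `[< same_orbit (vact X) K (L o) (L i) >]] =
            [pick i | `[< same_orbit (vact X) K (L o') (L i) >]].
    apply: eq_pick => i; apply: asbool_equiv_eq; split=> h.
      exact: (same_orbit_trans sK (same_orbit_sym sK oo') h).
    exact: (same_orbit_trans sK oo' h).
  case: pickP => // /(_ o') /asboolP[].
  exact: same_orbit_refl.
have /boolp.choice[c hc] : forall o, exists c, K c /\ L o = vact X c (L (rho o)).
  by move=> o; have [c Kc ho] := rhoP o; exists c.
pose St o := K `&` [set g | vact X g (L o) = L o].
have sSt o : subgroup (St o).
  apply: subgroupI => //; split=> [|g h /= hg hh]; first by rewrite /= gact1.
  by rewrite gactM -{1}hh gactK.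
have /boolp.choice[st hst] : forall o, exists s : seq G,
    (size s <= rr)%N /\ St o = generated [set` s].
  move=> o; have [|s sr hs] := @stabV (L o) _ (sSt o); first by move=> g [].
  by exists s.
pose S := flatten [seq st o | o <- enum {: option J}] ++
          ([seq c o | o <- enum {: option J}] ++ [seq (nx j).2 | j <- enum J]).
have gS := generated_subgroup [set` S].
have cS o : generated [set` S] (c o).
  by apply: sub_generated; rewrite /= !mem_cat map_f ?mem_enum ?orbT.
have nxS j : generated [set` S] (nx j).2.
  by apply: sub_generated; rewrite /= !mem_cat [X in _ || (_ || X)]map_f ?mem_enum ?orbT.
have StS o : St o `<=` generated [set` S].
  rewrite (hst o).2; apply: generated_mono => g /= gs; rewrite !mem_cat.
  by apply/orP; left; apply/flattenP; exists (st o) => //; apply: map_f; rewrite mem_enum.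
have SK : [set` S] `<=` K.
  move=> g /=; rewrite !mem_cat => /or3P[/flattenP[_ /mapP[o _ ->] gs]||].
  - have : St o g by rewrite (hst o).2; apply: sub_generated.
    by case.
  - by case/mapP => o _ ->; case: (hc o).
  - by case/mapP => j _ ->; case: (hnx j).
have genK : generated [set` S] `<=` K by apply: generated_min.
have size_st t : (size (flatten [seq st o | o <- t]) <= size t * rr)%N.
  elim: t => //= o t IHt; rewrite size_cat mulSn leq_add //; by case: (hst o).
apply: (@gen_byP _ _ _ S) => //.
  rewrite !size_cat !size_map -!enumT -!cardE card_option leq_add2r.
  by apply: leq_trans (size_st _) _; rewrite -cardE card_option.
have trans k o o' : K k -> vact X k (L o) = L o' -> generated [set` S] k.
  move=> Kk ko.
  have e : rho o = rho o' by apply: rhoE; exists k.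
  have [Kc co] := hc o; have [Kc' co'] := hc o'.
  have : St (rho o) ((c o')^-1 * k * c o).
    split; first by do !apply: subgroupM => //; apply: subgroupV.
    by rewrite /= !gactM -co ko co' e gactK.
  move=> /StS h.
  have -> : k = c o' * ((c o')^-1 * k * c o) * (c o)^-1.
    by rewrite !mulgA mulgK mulgV mul1g.
  by apply: (subgroupM gS); [apply: (subgroupM gS) | apply: (subgroupV gS)].
have reach n u w : special u -> special w -> (dist u w < n)%N ->
    (exists o k, generated [set` S] k /\ u = vact X k (L o)) ->
    exists o k, generated [set` S] k /\ w = vact X k (L o).
  elim: n u => // n IHn u su sw; rewrite ltnS => dn [o [k [Sk uk]]].
  have [[|h t] gw] := geod_exists u w; first by case: gw => /= <- _; exists o, k.
  have oh : origin h = u by case: gw => -[].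
  have hw : sep h.1 u w by rewrite (geod_sep _ gw) inE eqxx.
  have sh : special_half h.
    by split; rewrite ?oh //; apply: in_hull_sep hw; apply: special_hull.
  have [j [g Kg hj]] := hl h sh.
  have Sg : generated [set` S] g.
    have Kk := genK _ Sk.
    suff h2 : generated [set` S] (k^-1 * g).
      by rewrite -(mulVKg k g); apply: (subgroupM gS).
    apply: (trans _ (Some j) o); first by apply: subgroupM => //; apply: subgroupV.
    by rewrite gactM /= -orgJ -hj oh uk gactK.
  have slj : special_half (l j).
    rewrite -(gactK (half_action X) g (l j)) -hj.
    by apply: special_halfJ => //; apply: subgroupV.
  have [Knx /(_ slj)[sz hz zmin]] := hnx j.
  set z := vact X (nx j).2 (L (nx j).1) in sz hz zmin.
  have uE : u = vact X g (origin (l j)) by rewrite -oh hj orgJ.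
  have hE : h.1 = eact X g (l j).1 by rewrite hj.
  apply: (IHn (vact X g z)) => //.
  - exact: specialJ.
  - apply: leq_trans (special_closest su _ sw gw _ _) dn.
    + exact: specialJ.
    + by rewrite uE hE sepJ.
    + move=> w' sw' hw'; rewrite uE distJ.
      rewrite -[w'](gactKV (vact X) g) distJ; apply: zmin.
        by apply: specialJ => //; apply: subgroupV.
      by rewrite -(sepJ g) gactKV -hE -uE.
  - exists (nx j).1, (g * (nx j).2); split; last by rewrite gactM.
    exact: (subgroupM gS).
move=> k Kk.
have [||||o [k' [Sk' kp]]] := reach (dist p (vact X k p)).+1 p (vact X k p) => //.
- exact: special_base.
- by apply: specialJ => //; apply: special_base.
- by exists None, 1; rewrite gact1; split=> //; apply: (subgroup1 gS).
have Kk' := genK _ Sk'.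
suff : generated [set` S] (k'^-1 * k).
  by move=> h; rewrite -(mulVKg k' k); apply: (subgroupM gS).
apply: (trans _ None o); first by apply: subgroupM => //; apply: subgroupV.
by rewrite gactM /= kp gactK.
Qed.

End Generation.

(** * The rank of an intersection *)

Section IntersectionRank.
Local Open Scope classical_set_scope.
Local Open Scope group_scope.
Variables (G : groupType) (X : gtree G) (m rr : nat) (p : tvert X).
Hypothesis stabE : forall e : tedge X, exists2 s : seq G,
  (size s <= m)%N & forall g, eact X g e = e -> g \in s.
Hypothesis stabV : forall (v : tvert X) (L : set G), subgroup L ->
  (forall g, L g -> vact X g v = v) -> gen_by L rr.
Hypothesis RF : forall F : seq G,
  (forall x, x \in F -> x <> 1 /\ exists v, vact X x v = v) ->
  exists (B : finType) (act : gaction G B) (b0 : B),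
    forall x, x \in F -> forall b, act x b <> b.

Lemma branch_half_mono (K H : set G) h : K `<=` H ->
  branch_half p K h -> branch_half p H h.
Proof.
move=> KH.
have he e : hull_edge p K e -> hull_edge p H e.
  by move=> [a [b [/KH Ha /KH Hb ab]]]; exists a, b.
move=> [/he hh [s [us hs] s3]]; split=> //; exists s => //; split=> // k /hs[? /he].
by split.
Qed.

(** [K] has at most [36 m^3 (n1 + 1) (n2 + 1)] orbits of branch half-edges, from
    [6 m (n1 + 1)] for [H1], [6 m (n2 + 1)] for [H2] and a factor [m] for the
    intersection; the base point adds at most two half-edges and itself. *)
Definition rank_bound n1 n2 :=
  ((36 * m ^ 3 * (n1 + 1) * (n2 + 1) + 3) * (rr + 2))%N.

Lemma rank_setI (H1 H2 : set G) n1 n2 : subgroup H1 -> subgroup H2 ->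
  gen_by H1 n1 -> gen_by H2 n2 -> gen_by (H1 `&` H2) (rank_bound n1 n2).
Proof.
move=> s1 s2 [g1 g1n Hg1] [g2 g2n Hg2].
have [N1 [r1 [N1_le h1]]] := branch_bound p s1 stabE RF Hg1.
have [N2 [r2 [N2_le h2]]] := branch_bound p s2 stabE RF Hg2.
have [||r hr] := orbits_setI (half_transporter stabE) (r1 := r1) (r2 := r2)
    (W := [set h | branch_half p (H1 `&` H2) h]) s1 s2.
- by move=> h /= hb; apply: h1; apply: branch_half_mono hb => x [].
- by move=> h /= hb; apply: h2; apply: branch_half_mono hb => x [].
have sK := subgroupI s1 s2.
have [J [l [Jle hl]]] := special_half_cover sK hr.
apply: gen_by_mono (gen_by_special sK stabV hl).
rewrite !card_prod !card_ord in Jle.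
set nJ := #|J| in Jle *.
have hJ : (nJ <= 36 * m ^ 3 * (n1 + 1) * (n2 + 1) + 2)%N.
  apply: leq_trans Jle _; rewrite leq_add2r.
  have -> : (36 * m ^ 3 * (n1 + 1) * (n2 + 1) =
             6 * m * (n1 + 1) * (6 * m * (n2 + 1)) * m)%N.
    by rewrite !expnS expn0; lia.
  rewrite leq_mul2r; apply/orP; right; apply: leq_mul.
    by apply: leq_trans N1_le _; rewrite leq_mul2l leq_add2r g1n orbT.
  by apply: leq_trans N2_le _; rewrite leq_mul2l leq_add2r g2n orbT.
rewrite /rank_bound; move: hJ; set Q := (36 * _ * _ * _)%N => hJ.
have : (nJ.+1 * rr <= (Q + 3) * rr)%N by rewrite leq_mul2r; apply/orP; right; lia.
rewrite mulnDr; lia.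
Qed.

End IntersectionRank.

Section CyclicSubgroups.
Local Open Scope classical_set_scope.
Local Open Scope group_scope.
Variable G : groupType.

Lemma gen_by_sub_cyclic (H K : set G) : subgroup H -> gen_by H 1 ->
  subgroup K -> K `<=` H -> gen_by K 1.
Proof.
move=> sH [s s1 Hs] sK KH.
pose x := head 1 s.
have Hx : H `<=` generated [set x].
  rewrite Hs; apply: generated_mono => y /=.
  rewrite /x; case: s s1 {Hs x} => [|a [|]] //= _; by rewrite inE => /eqP.
have hx : H x.
  rewrite /x; case: s Hs {x Hx s1} => [|a s] Hs; first exact: subgroup1.
  by rewrite Hs; apply: sub_generated; rewrite /= inE eqxx.
apply: (@gen_by_cyclic_ext _ H [set 1] K 0) => //.
- split=> //.
  + by split=> // a b -> ->; rewrite invg1 mulg1.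
  + by move=> a ->; apply: subgroup1.
  + by move=> a h -> _; rewrite /= mulg1 mulVg.
- exists x => // y /Hx xy; by exists y.
- apply: (@gen_byP _ _ _ [::]) => //.
    apply: subgroupI => //.
    by split=> // a b -> ->; rewrite invg1 mulg1.
  by move=> a [_ ->]; apply: (subgroup1 (generated_subgroup _)).
Qed.

End CyclicSubgroups.

(** * Stabilisers in the Bass-Serre tree *)

Section BassSerreStabilisers.
Local Open Scope classical_set_scope.
Local Open Scope group_scope.
Variables (GG : graph_of_groups) (T : {set edge (graph GG)}).
Hypothesis treeT : spanning_tree T.
Local Notation E := (edge (graph GG)).
Local Notation X := (bs_tree treeT).

Lemma bs_edge_stabiliser : (forall e : E, finite_set [set: egroup e]) ->
  exists m, forall e : tedge X, exists2 s : seq (pi1 T),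
    (size s <= m)%N & forall g, eact X g e = e -> g \in s.
Proof.
move=> finE.
have fin_seq (e : E) : {s : seq (egroup e) | [set: egroup e] = [set` s]}.
  by apply/cid/finite_seqP/finE.
exists (\max_(e : E) size (sval (fin_seq e)))%N => t.
have [e [pe [g ->]]] := bs_edgeP t.
exists [seq g * pv T (emap e h) * g^-1 | h <- sval (fin_seq e)].
  by rewrite size_map; apply: (leq_bigmax e).
move=> x; rewrite [eact _ _ _]bs_eact_mke => /mke_eq.
move=> /(subgroupV (@esub_subgroup _ _ e))[h _ hx].
apply/mapP; exists h.
  suff : [set` sval (fin_seq e)] h by [].
  by rewrite -(svalP (fin_seq e)).
by rewrite hx invgM invgK !mulgA mulgV mul1g mulgK.
Qed.

Lemma bs_vertex_stabiliser :
  (forall v : vertex (graph GG), virtually_polycyclic (vgroup v)) ->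
  exists rr, forall (v : tvert X) (L : set (pi1 T)), subgroup L ->
    (forall g, L g -> vact X g v = v) -> gen_by L rr.
Proof.
move=> vpV.
have /boolp.choice[rk hrk] : forall v : vertex (graph GG), exists r,
    forall K : set (vgroup v), subgroup K -> gen_by K r.
  by move=> v; apply: virtually_polycyclic_rank.
exists (\max_v rk v)%N => t L sL hL.
have [v [g tE]] := bs_vertP t; rewrite {}tE in hL.
have Lv x : L x -> exists h : vgroup v, x = g * pv T h * g^-1.
  move=> /hL; rewrite [vact _ _ _]bs_vact_mkv => /mkv_eq.
  move=> /(subgroupV (@vsub_subgroup _ _ v))[h _ hx].
  by exists h; rewrite hx invgM invgK !mulgA mulgV mul1g mulgK.
pose f h := g * @pv GG T v h * g^-1.
have fM : {morph f : a b / a * b} by move=> a b; rewrite /f pvM !mulgA mulgVK.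
have sfL : subgroup [set h | L (f h)].
  split=> [|a b /= La Lb]; first by rewrite /= (morph1 fM); apply: subgroup1.
  by rewrite fM (morphV fM); apply: subgroupM => //; apply: subgroupV.
have [s sr Ls] := hrk v _ sfL.
apply: (@gen_by_mono _ _ (rk v)); first exact: leq_bigmax.
apply: (@gen_byP _ _ _ [seq f h | h <- s]); rewrite ?size_map //.
  move=> _ /mapP[h hs ->]; suff : [set h | L (f h)] h by [].
  by rewrite Ls; apply: sub_generated.
move=> x Lx; have [h hx] := Lv x Lx; rewrite hx in Lx *.
have gS := generated_subgroup [set` [seq f h | h <- s]].
suff : [set h | L (f h)] `<=` [set h | generated [set` [seq f h | h <- s]] (f h)].
  exact.
rewrite Ls; apply: generated_min => [|a /= as_].
  split=> [|a b /= ha hb]; first by rewrite /= (morph1 fM); apply: (subgroup1 gS).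
  by rewrite fM (morphV fM); apply: (subgroupM gS) => //; apply: (subgroupV gS).
by apply: sub_generated => /=; apply: map_f.
Qed.

(** An element that fixes a vertex is conjugate to an element of a vertex group,
    and so is without fixed points wherever the latter is. *)
Lemma bs_resid_fin :
  (forall v : vertex (graph GG), virtually_polycyclic (vgroup v)) ->
  (forall e : E, finite_set [set: egroup e]) ->
  forall F : seq (pi1 T),
  (forall x, x \in F -> x <> 1 /\ exists v, vact X x v = v) ->
  exists (B : finType) (act : gaction (pi1 T) B) (b0 : B),
    forall x, x \in F -> forall b, act x b <> b.
Proof.
move=> vpV finE F hF; have [symT connT acT] := treeT.
have rfV (v : vertex (graph GG)) (y : vgroup v) : y <> 1 -> exists (Q : finGroupType)
    (f : vgroup v -> Q), {morph f : a b / a * b} /\ f y <> 1.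
  exact: virtually_polycyclic_resid_fin (vpV v).
have [v0 _] : exists v : vertex (graph GG), true.
  by have /card_gt0P[v _] := vertex_gt0 (graph GG); exists v.
have /boolp.choice[d hd] : forall x, exists d : {v & @vgroup GG v}, x \in F ->
    tagged d <> 1 /\ exists g, x = g * pv T (tagged d) * g^-1.
  move=> x; have [xF|xF] := boolP (x \in F); last first.
    by exists (Tagged (@vgroup GG) (1 : vgroup v0)).
  have [x1 [t]] := hF x xF; have [v [g ->]] := bs_vertP t.
  rewrite [vact _ _ _]bs_vact_mkv => /mkv_eq.
  move=> /(subgroupV (@vsub_subgroup _ _ v))[h _ hx].
  have xE : x = g * pv T h * g^-1.
    by rewrite hx invgM invgK !mulgA mulgV mul1g mulgK.
  exists (Tagged (@vgroup GG) h) => _; split; last by exists g.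
  move=> /= h1; apply: x1.
  by rewrite xE h1 (morph1 (@pvM _ _ _)) mulg1 mulgV.
have [|B [act [b0 [act1 actM hact]]]] :=
    pi1_finite_action symT acT rfV finE (L := [seq d x | x <- F]).
  by move=> _ /mapP[x xF ->]; case: (hd x xF).
exists B, (GAction act1 actM), b0 => x xF b /= xb.
have [_ [g xE]] := hd x xF.
apply: (hact (d x) (map_f _ xF) (act g^-1 b)).
rewrite -actM.
have -> : pv T (tagged (d x)) * g^-1 = g^-1 * x.
  by rewrite [X in _ = g^-1 * X]xE !mulgA mulVg mul1g.
by rewrite actM; congr (act _ _).
Qed.

End BassSerreStabilisers.

(** * The theorem *)

Local Open Scope ring_scope.

Theorem theorem3p10 (R : realType) (GG : graph_of_groups)
    (T : {set edge (graph GG)}) :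
  spanning_tree T ->
  (forall v : vertex (graph GG), virtually_polycyclic (vgroup v)) ->
  (forall e : edge (graph GG), finite_set [set: egroup e]%classic) ->
  strongly_howson R (pi1 T) /\
  exists M : R, 0 < M /\
    forall n1 n2 : nat, (1 <= n1)%N -> (1 <= n2)%N ->
      (xi R (pi1 T) n1 n2 <= (M * (n1%:R - 1) * (n2%:R - 1) + M)%:E)%E.
Proof.
move=> treeT vpV finE.
have [m stabE] := bs_edge_stabiliser treeT finE.
have [rr stabV] := bs_vertex_stabiliser treeT vpV.
have RF := bs_resid_fin (treeT := treeT) vpV finE.
have [v0 _] : exists v : vertex (graph GG), true.
  by have /card_gt0P[v _] := vertex_gt0 (graph GG); exists v.
have rank := rank_setI (mkv v0 (1%g : pi1 T) : tvert (bs_tree treeT)) stabE stabV RF.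
pose rb := rank_bound m rr.
have xi_le n1 n2 b : (forall H1 H2 : set (pi1 T), subgroup H1 -> subgroup H2 ->
    gen_by H1 n1 -> gen_by H2 n2 -> gen_by (H1 `&` H2)%classic b) ->
    (xi R (pi1 T) n1 n2 <= b%:R%:E)%E.
  move=> h; apply: ge_ereal_sup => _ [H1 [H2 [s1 s2 /rk_gen_by g1 /rk_gen_by g2 ->]]].
  by apply: gen_by_rk; apply: h.
split=> [n1 n2|].
  apply: le_lt_trans (xi_le n1 n2 (rb n1 n2) _) (ltry _) => H1 H2 s1 s2.
  exact: rank.
(* [(n1 + 1) (n2 + 1) <= 4 n1 n2], which gives [144 = 36 * 4], and
   [n1 n2 <= 4 (n1 - 1) (n2 - 1)] when both are at least [2]. *)
pose C := ((144 * m ^ 3 + 3) * (rr + 2))%N.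
exists (4 * C + 1)%:R; split; first by rewrite ltr0n addn1.
move=> n1 n2 n1_gt0 n2_gt0.
have -> : (4 * C + 1)%:R * (n1%:R - 1) * (n2%:R - 1) + (4 * C + 1)%:R =
    ((4 * C + 1) * (n1 - 1) * (n2 - 1) + (4 * C + 1))%:R :> R.
  by rewrite [RHS]natrD !natrM !natrB.
apply: xi_le => H1 H2 s1 s2 g1 g2.
have sI := subgroupI s1 s2.
have [n11|n1_gt1] := leqP n1 1.
  apply: (@gen_by_mono _ _ 1); first lia.
  by apply: (gen_by_sub_cyclic s1 (gen_by_mono n11 g1) sI) => x [].
have [n21|n2_gt1] := leqP n2 1.
  apply: (@gen_by_mono _ _ 1); first lia.
  by apply: (gen_by_sub_cyclic s2 (gen_by_mono n21 g2) sI) => x [].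
apply: gen_by_mono (rank H1 H2 n1 n2 s1 s2 g1 g2).
rewrite /rank_bound.
case: n1 n2 n1_gt0 n2_gt0 g1 g2 n1_gt1 n2_gt1 => [|[|a]] // [|[|b]] // *.
rewrite /C !subn1 /=; move: (m ^ 3)%N (rr + 2)%N => w y.
nia.
Qed.
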